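(* Let $\mathcal A$ be a hyperplane arrangement in $\mathbb K^3$, $H\in\mathcal A$ and $\mathcal A':=\mathcal A\setminus\{H\}$ (with $\mathcal A$ and $\mathcal A'$ essential). (1) Assume that $\mathcal A$ is free with exponents $\exp(\mathcal A)=(1,d_2,d_3)$, $1\le d_2\le d_3$. Then $r(\mathcal A')=d_2-1$ if and only if $|\mathcal A^H|=1+d_3$. Otherwise $r(\mathcal A')=d_2$. (2) Assume that $\mathcal A'$ is free with exponents $\exp(\mathcal A')=(1,d_2,d_3)$, $1\le d_2\le d_3$. Then $r(\mathcal A)=d_2+1$ if and only if $|\mathcal A^H|\ne 1+d_2$. Otherwise $r(\mathcal A)=d_2$.
   Context: $\mathbb K$ is a field of characteristic zero, $S=\mathbb K[x_1,x_2,x_3]$ with the standard grading, and $\operatorname{Der} S=\bigoplus_{i=1}^3 S\,\partial_{x_i}$, where $\sum a_i\partial_{x_i}$ is homogeneous of degree $e$ if all $a_i\in S_e$; $\theta_E=\sum x_i\partial_{x_i}$ is the Euler derivation. A hyperplane arrangement in $\mathbb K^3$ is a finite set of (distinct) linear planes of $\mathbb K^3$ (equivalently, a line arrangement in $\mathbb P^2$); it is essential if the planes intersect only in $0$. For each plane $H$ fix a linear form $\alpha_H$ with $\ker\alpha_H=H$, and let $Q(\mathcal A)=\prod_{H\in\mathcal A}\alpha_H$. Let $D(\mathcal A)=\{\theta\in\operatorname{Der}S\mid\theta(\alpha_H)\in S\alpha_H\ \forall H\in\mathcal A\}$, $D_0(\mathcal A)=\{\theta\in\operatorname{Der}S\mid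 \theta(Q(\mathcal A))=0\}$ (so $D(\mathcal A)=D_0(\mathcal A)\oplus S\theta_E$) and $r(\mathcal A)=\min\{e\mid D_0(\mathcal A)_e\ne 0\}$. $\mathcal A$ is free with exponents $(1,d_2,d_3)$ if $D(\mathcal A)$ is a free $S$-module with a homogeneous basis $\theta_E,\theta_2,\theta_3$, $\deg\theta_i=d_i$. For $H\in\mathcal A$, $\mathcal A^H=\{H\cap L\mid L\in\mathcal A\setminus\{H\}\}$. *)

(* Defs.v *)
From HB Require Import structures.
From mathcomp Require Import all_boot all_order all_algebra.
From mathcomp Require Import finmap mpoly.
From Stdlib Require Import ClassicalEpsilon.
Set Implicit Arguments.
Unset Strict Implicit.
Unset Printing Implicit Defensive.
Import GRing.Theory.
Local Open Scope ring_scope.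
Local Open Scope fset_scope.

Section Arrangements.
Variable K : fieldType.

Notation V := 'rV[K]_3.
Notation S := {mpoly K[3]}.
(* The row (a_1, a_2, a_3) stands for the derivation a_1 d/dx_1 + a_2 d/dx_2
   + a_3 d/dx_3; this identifies Der S with S^3 as an S-module. *)
Notation Der := 'rV[{mpoly K[3]}]_3.

Implicit Types (A : {fset {vspace V}}) (alpha : {vspace V} -> S) (t : Der).

Definition arrangement A := forall H, H \in A -> \dim H = 2%N.

Definition essential A := (\bigcap_(H <- A) H)%VS = 0%VS.

(* [0] is homogeneous of every degree, but its kernel is not a plane. *)
Definition linear_form_of (H : {vspace V}) (f : S) :=
  f \is 1.-homog /\ forall v : V, (v \in H) = (f.@[fun i => v 0 i] == 0).

Definition restriction A (H : {vspace V}) : {fset {vspace V}} :=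
  [fset (H :&: L)%VS | L in A `\ H].

Definition Qpoly alpha A : S := \prod_(H <- A) alpha H.

Definition der_app t (f : S) : S := \sum_(i < 3) t 0 i * f^`M(i).

Definition der_homog (e : nat) t := forall i, t 0 i \is e.-homog.

Definition eulerD : Der := \row_(i < 3) 'X_i.

Definition logder alpha A t :=
  forall H, H \in A -> exists g : S, der_app t (alpha H) = g * alpha H.

Definition logder0 alpha A t := der_app t (Qpoly alpha A) = 0.

Definition logder0_nonzero alpha A (e : nat) :=
  exists t, [/\ t != 0, der_homog e t & logder0 alpha A t].

Definition is_least (P : nat -> Prop) (e : nat) :=
  P e /\ forall e', P e' -> (e <= e')%N.

(* For valid forms the minimum exists, so [mdr] is not a junk value: see
   [mdrP] below. *)
Definition mdr alpha A : nat :=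
  epsilon (inhabits 0%N) (is_least (logder0_nonzero alpha A)).

Definition is_basis (M : Der -> Prop) (b : 'I_3 -> Der) :=
  (forall i, M (b i)) /\
  forall t, M t -> exists! c : 'rV[S]_3, t = \sum_(i < 3) c 0 i *: b i.

Definition free_with_exponents alpha A (d2 d3 : nat) :=
  exists t2 t3 : Der,
    [/\ der_homog d2 t2, der_homog d3 t3
      & is_basis (logder alpha A) (fun i => [:: eulerD; t2; t3]`_i)].

Lemma least_exists (P : nat -> Prop) : (exists e, P e) -> exists e, is_least P e.
Proof.
case=> e; elim/ltn_ind: e => e IH Pe.
case: (excluded_middle_informative (exists2 e', (e' < e)%N & P e')).
  by case=> e' lt_e' Pe'; exact: IH lt_e' Pe'.
move=> no; exists e; split=> // e' Pe'.
by rewrite leqNgt; apply/negP=> lt_e'; apply: no; exists e'.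
Qed.

Lemma logder0_nonzero_exists alpha A :
    (forall H, H \in A -> linear_form_of H (alpha H)) ->
  exists e, logder0_nonzero alpha A e.
Proof.
move=> hal; set Q := Qpoly alpha A.
have hQ : Q \is (size A).-homog.
  rewrite /Q /Qpoly big_seq.
  have -> : size A = (\sum_(H <- A | H \in A) 1)%N.
    by rewrite -big_seq sum1_size.
  elim/big_rec2: _ => [|H d f HA hf]; first exact: dhomog1.
  by apply: dhomogM => //; case: (hal H HA).
pose i0 : 'I_3 := inord 0; pose i1 : 'I_3 := inord 1.
have i01 : i1 != i0 by rewrite -val_eqE /= !inordK.
have [Q0|Q0] := eqVneq (Q^`M(i0)) 0.
  exists 0%N, (delta_mx 0 i0); split.
  - apply/eqP=> /rowP/(_ i0)/eqP.
    by rewrite !mxE !eqxx /= oner_eq0.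
  - move=> i; rewrite !mxE eqxx /=.
    by case: (i == i0); rewrite ?rpred0 // dhomog1.
  - rewrite /logder0 /der_app big1 // => i _; rewrite mxE eqxx /=.
    by case: eqP => [->|_]; rewrite -/Q ?Q0 ?mulr0 ?mul0r.
pose t : Der := Q^`M(i1) *: delta_mx 0 i0 - Q^`M(i0) *: delta_mx 0 i1.
exists (size A).-1, t; split.
- apply/eqP=> /rowP/(_ i1)/eqP.
  by rewrite !mxE !eqxx (negPf i01) /= mulr0 mulr1 add0r oppr_eq0 (negPf Q0).
- have hd i : Q^`M(i) \is ((size A).-1).-homog.
    apply/dhomogP=> m; rewrite mcoeff_msupp mcoeff_mderiv => nz.
    have : (m + U_(i))%MM \in msupp Q.
      by rewrite mcoeff_msupp; apply: contraNneq nz => ->; rewrite mul0rn.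
    by move/(dhomogP _ _ _ hQ) => /= <-; rewrite mdegD mdeg1 addn1.
  move=> i; rewrite !mxE eqxx /= rpredB //.
    by case: (i == i0); rewrite ?mulr1 ?mulr0 ?rpred0.
  by case: (i == i1); rewrite ?mulr1 ?mulr0 ?rpred0.
- rewrite /logder0 /der_app (bigD1 i0) //= (bigD1 i1) //= big1.
    rewrite !mxE !eqxx (negPf i01) eq_sym (negPf i01) /= -/Q.
    by rewrite !mulr1 !mulr0 subr0 add0r addr0 mulNr mulrC subrr.
  move=> i /andP[/negPf h0 /negPf h1].
  by rewrite !mxE eqxx h0 h1 /= !mulr0 subrr mul0r.
Qed.

Lemma mdrP alpha A :
    (forall H, H \in A -> linear_form_of H (alpha H)) ->
  is_least (logder0_nonzero alpha A) (mdr alpha A).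
Proof.
by move=> /logder0_nonzero_exists/least_exists; apply: epsilon_spec.
Qed.

End Arrangements.

(* Main.v *)
Require Import Defs.
From mathcomp Require Import all_boot all_order all_algebra.
From mathcomp Require Import finmap mpoly.
From mathcomp Require Import ring zify.
Set Implicit Arguments.
Unset Strict Implicit.
Unset Printing Implicit Defensive.
Import GRing.Theory.
Local Open Scope ring_scope.

(** Write [E] for the Euler derivation, [D(A)] for the logarithmic derivations and
    [Q] for the product of the forms. In characteristic zero
    [D(A) = D_0(A) + S E], so the invariant of the theorem is the least degree of an
    element of [D(A)] outside [S E] (such elements are called proper below). Since
    [D(A) <= D(A')] and [alpha_H D(A') <= D(A)], passing from [A] to [A'] keeps this
    degree or lowers it by one. In both parts this leaves two candidates, and the number
    of points of [A^H] has to decide between them.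

    Everything happens modulo [alpha_H], and two divisibilities count the points.
    If [t] lies in [D(A)], then along [H] both [E] and [t] are tangent to every line
    [X] of [A^H], so the determinant [wedge t] of their restrictions to [H] is
    divisible by the equation of [A^H], of degree [#|A^H|]
    ([Qrestriction_divides_wedge]). If [u] lies in [D(A')], then [u(alpha_H)] is
    divisible by [alpha_X^(m_X - 1)], where [m_X] is the number of planes of [A']
    through [X], hence by a polynomial of degree [#|A'| - #|A^H|]
    ([red_Qpoly_divides]).

    Suppose that the smaller candidate is attained. A derivation of that degree can be
    exchanged for a basis element ([free_exchange]), and Saito's criterion ([saito])
    provides [t] in [D(A)] and [u] in [D(A')] with [det (E, t, u) = c Q(A')]. By
    Cramer's rule this determinant is [u(alpha_H) wedge t] modulo [alpha_H], up to
    a constant, and it is not zero there. The two divisibilities then bound the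
    number of points on both sides ([restriction_card_bounds]); as the degrees of a
    basis add up to the number of planes, the bounds coincide and give the value in
    the theorem.

    Conversely, if [#|A^H|] has this value, then for degree reasons a linear
    combination of the two basis elements other than [E] lies in the kernel of
    [wedge], resp. of [u |-> u(alpha_H)] modulo [alpha_H] ([free_kernel]). In the
    first case it is a multiple of [alpha_H] up to a multiple of [E] ([wedge_eq0]),
    and dividing by [alpha_H] gives a derivation of [A'] of degree [d2 - 1]; in the
    second case it belongs to [D(A)] and has degree [d2]. *)

(** * Divisibility in a domain *)

Section Divisibility.
Variable R : idomainType.
Implicit Types p q r f g h : R.

Definition divides p q := exists g, q = g * p.

(** Coprimality in a form that needs neither gcds nor factorizations: [q] is not
    a zero divisor modulo [p]. *)
Definition coprime_to p q := forall h, divides p (q * h) -> divides p h.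

Definition prime_elt p := forall f g, divides p (f * g) -> divides p f \/ divides p g.

Lemma dividesMl p q r : divides p q -> divides p (r * q).
Proof. by case=> g ->; exists (r * g); rewrite mulrA. Qed.

Lemma dividesMr p q r : divides p q -> divides p (q * r).
Proof. by rewrite mulrC; apply: dividesMl. Qed.

Lemma dividesD p q r : divides p q -> divides p r -> divides p (q + r).
Proof. by case=> g -> [h ->]; exists (g + h); rewrite mulrDl. Qed.

Lemma dividesN p q : divides p q -> divides p (- q).
Proof. by case=> g ->; exists (- g); rewrite mulNr. Qed.

Lemma dividesB p q r : divides p q -> divides p r -> divides p (q - r).
Proof. by move=> pq pr; apply: dividesD => //; apply: dividesN. Qed.

Lemma dividesxx p : divides p p.
Proof. by exists 1; rewrite mul1r. Qed.

Lemma divides_trans p q r : divides p q -> divides q r -> divides p r.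
Proof. by case=> g -> [h ->]; exists (h * g); rewrite mulrA. Qed.

Lemma divides_cancel p q r : r != 0 -> divides (r * p) (r * q) -> divides p q.
Proof.
move=> r0 [g e]; exists g; apply: (mulfI r0).
by rewrite e; ring.
Qed.

Lemma prime_prod (I : eqType) (s : seq I) (F : I -> R) p :
    prime_elt p -> ~ divides p 1 -> divides p (\prod_(i <- s) F i) ->
  exists2 i, i \in s & divides p (F i).
Proof.
move=> pp p1; elim: s => [|i s IH]; first by rewrite big_nil => /p1.
rewrite big_cons => /pp[pFi|/IH[j js pFj]]; first by exists i; rewrite ?mem_head.
by exists j => //; rewrite inE js orbT.
Qed.

Lemma coprime_to_prime p q : prime_elt p -> ~ divides p q -> coprime_to p q.
Proof. by move=> pp pq h /pp[/pq|]. Qed.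

(** The prime factors of the product can be cancelled one after the other, with
    multiplicity. *)
Lemma coprime_to_prod (I : eqType) (s : seq I) (P : pred I) (F : I -> R) q :
    (forall i, i \in s -> P i ->
      [/\ F i != 0, prime_elt (F i) & ~ divides (F i) q]) ->
  coprime_to (\prod_(i <- s | P i) F i) q.
Proof.
elim: s => [|i s IH] Fs h; first by rewrite big_nil => _; exists h; rewrite mulr1.
have {}IH := IH (fun j js => Fs j (mem_behead (s := i :: s) js)).
rewrite big_cons; case: ifP => Pi; last by exact: IH.
have [Fi0 pFi Fiq] := Fs i (mem_head _ _) Pi.
move=> dv.
have /pFi[//|[h' eh]] : divides (F i) (q * h).
  by apply: divides_trans dv; apply: dividesMr; apply: dividesxx.
have /IH[g eg] : divides (\prod_(j <- s | P j) F j) (q * h').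
  by apply: (divides_cancel Fi0); rewrite mulrCA [F i * h']mulrC -eh.
by exists g; rewrite eh eg; ring.
Qed.

Lemma prod_divides (I : eqType) (s : seq I) (F : I -> R) f :
    uniq s -> (forall i, i \in s -> divides (F i) f) ->
    (forall i j, i \in s -> j \in s -> i != j -> coprime_to (F i) (F j)) ->
  divides (\prod_(i <- s) F i) f.
Proof.
move=> + Ff cop.
have: {subset s <= s} by [].
elim: {1 3 4}s => [|i r IH] sub; first by rewrite big_nil; exists f; rewrite mulr1.
rewrite cons_uniq => /andP[ir ur].
have is_ : i \in s by apply: sub; rewrite mem_head.
have {}sub : {subset r <= s} by move=> j jr; apply: sub; rewrite inE jr orbT.
have [g ef] := IH sub ur.
suff [h eg] : divides (F i) g by exists h; rewrite big_cons ef eg mulrA.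
have := Ff i is_; rewrite ef mulrC; elim: r ir sub {IH ur ef} => [|j r IH] ir sub.
  by rewrite big_nil mul1r.
move: ir; rewrite inE negb_or => /andP[ij ir].
rewrite big_cons -mulrA => /(cop i j is_ (sub j (mem_head _ _)) ij).
by apply: IH => // l lr; apply: sub; rewrite inE lr orbT.
Qed.

End Divisibility.

(** * Homogeneous polynomials *)

Section Homogeneous.
Variables (K : fieldType) (n : nat).
Implicit Types p q f g : {mpoly K[n]}.

Lemma dhomog_const f : f \is 0.-homog -> exists c, f = c%:MP.
Proof.
move=> hf; exists (f@_0); apply/mpolyP => m; rewrite mcoeffC.
case: eqP => [->|/eqP m0]; first by rewrite mulr1.
by rewrite mulr0 (dhomog_nemf_coeff hf) // mdeg_eq0.
Qed.

Lemma pihomogM d e p q : p \is d.-homog ->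
  pihomog mdeg e (q * p) = if (d <= e)%N then pihomog mdeg (e - d) q * p else 0.
Proof.
move=> hp; pose N := (maxn (msize q) (e - d).+1).
rewrite [in LHS](@pihomog_partitionE _ _ mdeg N q) ?leq_maxl //.
rewrite mulr_suml linear_sum /=.
have piE (i : nat) : pihomog mdeg e (pihomog mdeg i q * p) =
    if (i + d == e)%N then pihomog mdeg i q * p else 0.
  have hq : pihomog mdeg i q * p \is (i + d).-homog.
    by apply: dhomogM => //; apply: pihomogP.
  case: eqP => [<-|/eqP ne]; first exact: pihomog_dE.
  exact: pihomog_ne0 ne hq.
under eq_bigr do rewrite piE.
case: leqP => de; last first.
  rewrite big1 // => i _; case: eqP => // e'.
  by move: de; rewrite -e' ltnNge leq_addl.
have lt : (e - d < N)%N by rewrite leq_max ltnSn orbT.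
rewrite (bigD1 (Ordinal lt)) //= subnK // eqxx big1 ?addr0 // => i ne.
by case: eqP => // ie; case/eqP: ne; apply: val_inj; rewrite /= -ie addnK.
Qed.

(** The component of degree [e] of [g * p] is [p] times the component of degree
    [e - d] of [g]. *)
Lemma dhomog_quotient d e p g : p != 0 -> p \is d.-homog -> g * p != 0 ->
  g * p \is e.-homog -> (d <= e)%N /\ g \is (e - d).-homog.
Proof.
move=> p0 hp gp0 hgp; have := pihomogM e g hp; rewrite (pihomog_dE hgp).
case: leqP => [de /(mulIf p0) ->|_ /eqP]; first by split => //; apply: pihomogP.
by rewrite (negPf gp0).
Qed.

Lemma dhomog_divides_leq d e p f : p \is d.-homog -> f \is e.-homog ->
  f != 0 -> divides p f -> (d <= e)%N.
Proof.
move=> hp hf f0 [g ef]; move: f0 hf; rewrite ef => f0 hf.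
have p0 : p != 0 by apply: contraNneq f0 => ->; rewrite mulr0.
by case: (dhomog_quotient p0 hp f0 hf).
Qed.

Lemma dhomog_divides_eq d p f : p \is d.-homog -> f \is d.-homog ->
  divides p f -> exists c, f = c *: p.
Proof.
move=> hp hf [g ef]; have [f0|f0] := eqVneq f 0; first by exists 0; rewrite scale0r.
move: f0 hf; rewrite ef => f0 hf.
have p0 : p != 0 by apply: contraNneq f0 => ->; rewrite mulr0.
have [_] := dhomog_quotient p0 hp f0 hf; rewrite subnn => /dhomog_const[c ->].
by exists c; rewrite mul_mpolyC.
Qed.

Lemma dhomog_prod_seq (I : eqType) (s : seq I) (F : I -> {mpoly K[n]}) :
    (forall i, i \in s -> F i \is 1.-homog) ->
  \prod_(i <- s) F i \is (\sum_(i <- s) 1)%N.-homog.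
Proof.
move=> hF; rewrite big_seq [X in X.-homog]big_seq.
elim/big_rec2: _ => [|i d f si hf]; first exact: dhomog1.
by apply: dhomogM => //; apply: hF.
Qed.

(** * Linear forms *)

Definition lin (a : 'I_n -> K) : {mpoly K[n]} := \sum_i a i *: 'X_i.

Lemma lin_dhomog a : lin a \is 1.-homog.
Proof. by apply: rpred_sum => i _; rewrite rpredZ // dhomogX /= mdeg1. Qed.

Lemma lin_coef a i : (lin a)@_U_(i) = a i.
Proof.
rewrite /lin linear_sum (bigD1 i) //= mcoeffZ mcoeffXU eqxx mulr1.
by rewrite big1 ?addr0 // => j /negPf ne; rewrite mcoeffZ mcoeffXU ne mulr0.
Qed.

Lemma dhomog1_lin f : f \is 1.-homog -> f = lin (fun i => f@_U_(i)).
Proof.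
move=> hf; apply/mpolyP => m.
have [/mdeg1P[i /eqP ->]|m1] := boolP (mdeg m == 1%N); first by rewrite lin_coef.
by rewrite (dhomog_nemf_coeff hf) // (dhomog_nemf_coeff (lin_dhomog _)).
Qed.

Lemma meval_lin a v : (lin a).@[v] = \sum_i a i * v i.
Proof.
rewrite /lin raddf_sum /=; apply: eq_bigr => i _.
by rewrite mevalZ mevalXU.
Qed.

Lemma mderiv_lin a i : (lin a)^`M(i) = (a i)%:MP.
Proof.
rewrite /lin linear_sum (bigD1 i) //= mderivZ mderivX mnm1E eqxx scale1r.
have -> : (U_(i) - U_(i))%MM = 0%MM :> 'X_{1..n}.
  by apply/mnmP => j; rewrite mnmBE subnn mnm0E.
rewrite mpolyX0 -mul_mpolyC mulr1.
rewrite big1 ?addr0 // => j /negPf ne.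
by rewrite mderivZ mderivX mnm1E ne scale0r scaler0.
Qed.

Lemma lin_neq0 f : f \is 1.-homog -> f != 0 -> exists k, f@_U_(k) != 0.
Proof.
move=> hf f0; apply/existsP; apply: contraNT f0 => /existsPn f0.
rewrite (dhomog1_lin hf) /lin big1 // => i _.
by move/negPn/eqP: (f0 i) => ->; rewrite scale0r.
Qed.

(** Two hyperplanes through the origin, one inside the other, have proportional
    equations: test the inclusion on the vectors [f_k e_i - f_i e_k]. *)
Lemma lin_kernel_sub f g : f \is 1.-homog -> g \is 1.-homog -> f != 0 ->
  (forall v, f.@[v] = 0 -> g.@[v] = 0) -> exists c, g = c *: f.
Proof.
move=> hf hg f0 fg; have [k fk0] := lin_neq0 hf f0.
exists (g@_U_(k) / f@_U_(k)).
rewrite [LHS](dhomog1_lin hg) [X in _ = _ *: X](dhomog1_lin hf) /lin scaler_sumr.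
apply: eq_bigr => i _; rewrite scalerA; congr (_ *: _).
apply: (mulIf fk0); rewrite mulrAC divfK //.
have [->//|ik] := eqVneq i k.
pose v j := if j == i then f@_U_(k) else if j == k then - f@_U_(i) else 0.
have ev a : \sum_j a j * v j = a i * f@_U_(k) - a k * f@_U_(i).
  have ki : k != i by rewrite eq_sym.
  rewrite (bigD1 i) //= (bigD1 k) //= /v !eqxx (negPf ki).
  rewrite big1 ?addr0 ?mulrN // => j /andP[/negPf -> /negPf ->].
  by rewrite mulr0.
have := fg v; rewrite (dhomog1_lin hf) (dhomog1_lin hg) !meval_lin !ev.
rewrite -(dhomog1_lin hf) -(dhomog1_lin hg).
by rewrite [X in X - _]mulrC subrr => /(_ erefl)/eqP; rewrite subr_eq0 => /eqP.
Qed.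

End Homogeneous.

(** * Reduction modulo a linear form *)

Section Reduction.
Variables (K : fieldType) (n : nat) (f : {mpoly K[n]}) (k : 'I_n).
Hypotheses (hf : f \is 1.-homog) (fk0 : f@_U_(k) != 0).
Implicit Types p q g h : {mpoly K[n]}.

(** Solving the equation [f = 0] for [x_k] gives an endomorphism of the
    polynomial ring with kernel [(f)]; its image is a copy of the quotient
    inside the ring itself, so that the quotient needs no type of its own. *)
Definition red_tuple : n.-tuple {mpoly K[n]} :=
  [tuple 'X_i - ((i == k)%:R / f@_U_(k)) *: f | i < n].

Local Notation red p := (p \mPo red_tuple).

Lemma redX i : red 'X_i = 'X_i - ((i == k)%:R / f@_U_(k)) *: f.
Proof. by rewrite comp_mpolyXU -tnth_nth tnth_mktuple. Qed.

Lemma redX_id i : i != k -> red 'X_i = 'X_i.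
Proof. by move=> /negPf ik; rewrite redX ik mul0r scale0r subr0. Qed.

Lemma redM p q : red (p * q) = red p * red q.
Proof. exact: rmorphM. Qed.

Lemma redD p q : red (p + q) = red p + red q.
Proof. exact: comp_mpolyD. Qed.

Lemma redB p q : red (p - q) = red p - red q.
Proof. exact: comp_mpolyB. Qed.

Lemma red_lin a : red (lin a) = \sum_i a i *: red 'X_i.
Proof. by rewrite /lin linear_sum; apply: eq_bigr => i _; rewrite linearZ. Qed.

Lemma red_self : red f = 0.
Proof.
rewrite {1}(dhomog1_lin hf) red_lin.
under eq_bigr do rewrite redX scalerBr.
rewrite sumrB -/(lin _) -(dhomog1_lin hf) (bigD1 k) //= eqxx.
rewrite scalerA mul1r divff // scale1r big1 ?addr0 ?subrr // => i /negPf ->.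
by rewrite mul0r scale0r scaler0.
Qed.

(** The congruence holds for constants and variables and is multiplicative. *)
Lemma red_sub p : divides f (p - red p).
Proof.
have redC c : divides f (c%:MP - red c%:MP).
  by rewrite comp_mpolyC subrr; exists 0; rewrite mul0r.
have redM q g : divides f (q - red q) -> divides f (g - red g) ->
    divides f (q * g - red (q * g)).
  move=> dq dg; rewrite rmorphM /=.
  have -> : q * g - red q * red g = (q - red q) * g + red q * (g - red g) by ring.
  by apply: dividesD; [apply: dividesMr | apply: dividesMl].
have redXm m : divides f ('X_[m] - red 'X_[m]).
  rewrite mpolyXE_id; apply: (big_ind (fun q => divides f (q - red q))) => //.
    by rewrite -mpolyC1; apply: redC.
  move=> i _; elim: (m i) => [|l IH]; first by rewrite expr0 -mpolyC1; apply: redC.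
  rewrite exprS; apply: redM => //; rewrite redX opprB addrC addrNK.
  by exists ((i == k)%:R / f@_U_(k))%:MP; rewrite mul_mpolyC.
rewrite [p]mpolyE; apply: (big_ind (fun q => divides f (q - red q))).
- by rewrite -(mpolyC0 n K); apply: redC.
- move=> q g dq dg; rewrite comp_mpolyD opprD addrACA; exact: dividesD.
- by move=> m _; rewrite -mul_mpolyC; apply: redM.
Qed.

Lemma red_eq0 p : red p = 0 <-> divides f p.
Proof.
split=> [rp|[g ->]]; last by rewrite rmorphM /= red_self mulr0.
by have := red_sub p; rewrite rp subr0.
Qed.

Lemma red_idem p : red (red p) = red p.
Proof.
have /red_eq0 := red_sub p; rewrite comp_mpolyB => /eqP.
by rewrite subr_eq0 => /eqP.
Qed.

Lemma red_divides p q : divides p q -> divides (red p) (red q).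
Proof. by case=> g ->; rewrite rmorphM; exists (red g). Qed.

Lemma red_dhomog d p : p \is d.-homog -> red p \is d.-homog.
Proof.
move=> /dhomogP hp; rewrite comp_mpolyEX big_seq.
apply: rpred_sum => m /hp /= <-; rewrite rpredZ //.
rewrite comp_mpolyX mdegE /=.
elim/big_rec2: _ => [|i d' q _ hq]; first exact: dhomog1.
apply: dhomogM => //; rewrite -[X in X.-homog]mul1n; apply: dhomogMn.
rewrite tnth_mktuple rpredB ?rpredZ //.
by rewrite dhomogX /= mdeg1.
Qed.

(** The quotient by [f] embeds into a polynomial ring, hence is a domain. *)
Lemma red_prime : prime_elt f.
Proof.
move=> p q /red_eq0; rewrite rmorphM /= => /eqP.
by rewrite mulf_eq0 => /orP[]/eqP/red_eq0; [left | right].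
Qed.

Lemma red_meval p v : f.@[v] = 0 -> (red p).@[v] = p.@[v].
Proof.
move=> fv; have [g /(congr1 (meval v))] := red_sub p.
rewrite mevalB mevalM fv mulr0 => /eqP.
by rewrite subr_eq0 => /eqP.
Qed.

(** The substitution maps the zeros of [red g] to points of [f = 0] where [g]
    vanishes, so that [lin_kernel_sub] applies to [red g] and [red h]. *)
Lemma red_pencil g h : g \is 1.-homog -> h \is 1.-homog -> red g != 0 ->
  (forall v, f.@[v] = 0 -> g.@[v] = 0 -> h.@[v] = 0) -> exists c, red h = c *: red g.
Proof.
move=> hg hh g0 gh; apply: lin_kernel_sub => //; try exact: red_dhomog.
move=> v; rewrite !comp_mpoly_meval.
apply: gh; rewrite -comp_mpoly_meval red_self; exact: meval0.
Qed.

End Reduction.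

Section LinearFormsArePrime.
Variables (K : fieldType) (n : nat).
Implicit Types f g : {mpoly K[n]}.

Lemma dhomog1_prime f : f \is 1.-homog -> f != 0 -> prime_elt f.
Proof. by move=> hf /(lin_neq0 hf)[k fk0]; apply: red_prime hf fk0. Qed.

Lemma dhomog1_not_unit f : f \is 1.-homog -> ~ divides f 1.
Proof.
move=> hf df; have := dhomog_divides_leq hf (dhomog1 _ _) _ df.
by rewrite oner_eq0 => /(_ isT).
Qed.

End LinearFormsArePrime.

(** * Derivations of the polynomial ring in three variables *)

(** Addition in ['I_3] is modulo 3, so [(k, k + 1, k + 1 + 1)] is an even
    permutation of the indices for each [k]. Writing sums and determinants along it
    leaves the index of the pivot [k] arbitrary; below it is a coordinate that occurs
    in the linear form under consideration. *)

Lemma big_ord3 (V : zmodType) (F : 'I_3 -> V) k :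
  \sum_i F i = F k + F (k + 1) + F (k + 1 + 1).
Proof.
rewrite !big_ord_recl big_ord0 addr0 addrA.
have [G FG] : exists G : nat -> V, forall i : 'I_3, F i = G i.
  by exists (fun i => F (inord i)) => i; rewrite inord_val.
rewrite !FG /=; case: k => [[|[|[|//]]] lk] /=.
- by [].
- by rewrite [RHS]addrC addrA.
- by rewrite -[RHS]addrA [RHS]addrC.
Qed.

Lemma ord3_cases (k n : 'I_3) : [\/ n = k, n = k + 1 | n = k + 1 + 1].
Proof.
case: k n => [[|[|[|//]]] ?] [[|[|[|//]]] ?]; by
  [constructor 1; apply: val_inj | constructor 2; apply: val_inj
  | constructor 3; apply: val_inj].
Qed.

Lemma det3E (R : comRingType) (M : 'M[R]_3) (k : 'I_3) :
  \det M = let i := k + 1 in let j := k + 1 + 1 in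
  M 0 k * (M 1 i * M (1 + 1) j - M 1 j * M (1 + 1) i) +
  M 0 i * (M 1 j * M (1 + 1) k - M 1 k * M (1 + 1) j) +
  M 0 j * (M 1 k * M (1 + 1) i - M 1 i * M (1 + 1) k).
Proof.
have [G MG] : exists G : nat -> nat -> R, forall i j : 'I_3, M i j = G i j.
  by exists (fun i j => M (inord i) (inord j)) => i j; rewrite !inord_val.
rewrite (expand_det_row _ 0) !big_ord_recl big_ord0 /cofactor.
rewrite !(expand_det_row _ 0) !big_ord_recl !big_ord0 /cofactor !det_mx11 !mxE.
rewrite !MG /= /bump /=.
case: k => [[|[|[|//]]] lk] /=; ring.
Qed.


Section Derivations.
Variable K : fieldType.
Notation S := {mpoly K[3]}.
Notation Der := 'rV[{mpoly K[3]}]_3.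
Implicit Types (t a b c : Der) (f g : S) (k : 'I_3).

(** Cramer's rule. Like the other identities of this kind it is stated for the
    variables of an abstract ring, where normalization is cheap, and then
    specialized to polynomials. *)
Lemma cramer3 (R : comRingType) (fk fi fj ak ai aj bk bi bj ck ci cj : R) :
  fk * (ak * (bi * cj - bj * ci) + ai * (bj * ck - bk * cj) + aj * (bk * ci - bi * ck)) =
  (fk * ak + fi * ai + fj * aj) * (bi * cj - bj * ci) +
  (fk * bk + fi * bi + fj * bj) * (ci * aj - cj * ai) +
  (fk * ck + fi * ci + fj * cj) * (ai * bj - aj * bi).
Proof. ring. Qed.

Definition der_det a b c : S := \det (\matrix_(i < 3) [:: a; b; c]`_i).

Lemma der_detE k a b c : der_det a b c =
  let i := k + 1 in let j := k + 1 + 1 in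
  a 0 k * (b 0 i * c 0 j - b 0 j * c 0 i) +
  a 0 i * (b 0 j * c 0 k - b 0 k * c 0 j) +
  a 0 j * (b 0 k * c 0 i - b 0 i * c 0 k).
Proof.
pose M := \matrix_(i < 3) [:: a; b; c]`_i.
have Ma l : M 0 l = a 0 l by rewrite mxE.
have Mb l : M 1 l = b 0 l by rewrite mxE.
have Mc l : M (1 + 1) l = c 0 l by rewrite mxE.
by rewrite /der_det -/M (det3E _ k) /= !Ma !Mb !Mc.
Qed.

Lemma der_det_triangular k a b c :
    a 0 (k + 1) = 0 -> a 0 (k + 1 + 1) = 0 -> b 0 (k + 1 + 1) = 0 ->
  der_det a b c = a 0 k * (b 0 (k + 1) * c 0 (k + 1 + 1)).
Proof.
move=> ai aj bj; rewrite (der_detE k) /= ai aj bj.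
by rewrite mul0r mul0r mul0r addr0 addr0 subr0.
Qed.

Lemma der_det_comb (b : 'I_3 -> Der) (c1 c2 c3 : 'rV[S]_3) :
  der_det (\sum_j c1 0 j *: b j) (\sum_j c2 0 j *: b j) (\sum_j c3 0 j *: b j) =
  \det (\matrix_(i < 3) [:: c1; c2; c3]`_i) * \det (\matrix_i b i).
Proof.
have sumE (c : 'rV[S]_3) : \sum_j c 0 j *: b j = c *m (\matrix_i b i).
  by rewrite mulmx_sum_row; apply: eq_bigr => j _; rewrite rowK.
rewrite /der_det -det_mulmx !sumE; congr (\det _).
apply/row_matrixP=> i; rewrite row_mul !rowK.
by case: i => [[|[|[|//]]] ?].
Qed.

Lemma der_appD t1 t2 f : der_app (t1 + t2) f = der_app t1 f + der_app t2 f.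
Proof. by rewrite -big_split; apply: eq_bigr => i _; rewrite mxE mulrDl. Qed.

Lemma der_appZ g t f : der_app (g *: t) f = g * der_app t f.
Proof. by rewrite mulr_sumr; apply: eq_bigr => i _; rewrite mxE mulrA. Qed.

Lemma der_appN t f : der_app (- t) f = - der_app t f.
Proof. by rewrite -scaleN1r der_appZ mulN1r. Qed.

Lemma der_appB t1 t2 f : der_app (t1 - t2) f = der_app t1 f - der_app t2 f.
Proof. by rewrite der_appD der_appN. Qed.

Lemma der_appM t f g : der_app t (f * g) = der_app t f * g + f * der_app t g.
Proof.
rewrite mulr_suml mulr_sumr -big_split; apply: eq_bigr => i _ /=.
by rewrite mderivM; ring.
Qed.

Lemma der_app1 t : der_app t 1 = 0.
Proof. by rewrite /der_app big1 // => i _; rewrite -mpolyC1 mderivC mulr0. Qed.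

Lemma der_app_lin t f : f \is 1.-homog ->
  der_app t f = \sum_i (f@_U_(i))%:MP * t 0 i.
Proof.
move=> hf; apply: eq_bigr => i _.
by rewrite {1}(dhomog1_lin hf) mderiv_lin mulrC.
Qed.

Lemma der_app_dhomog e t f : der_homog e t -> f \is 1.-homog ->
  der_app t f \is e.-homog.
Proof.
move=> ht hf; rewrite der_app_lin // rpred_sum // => i _.
by rewrite mul_mpolyC; apply/rpredZ/ht.
Qed.

Lemma euler_app f : f \is 1.-homog -> der_app (eulerD K) f = f.
Proof.
move=> hf; rewrite der_app_lin // [RHS](dhomog1_lin hf).
by apply: eq_bigr => i _; rewrite mxE mul_mpolyC.
Qed.

Lemma euler_homog : der_homog 1 (eulerD K).
Proof. by move=> i; rewrite mxE dhomogX /= mdeg1. Qed.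

End Derivations.

(** * Logarithmic derivations *)

Section Logarithmic.
Variables (K : fieldType) (alpha : {vspace 'rV[K]_3} -> {mpoly K[3]}).
Notation S := {mpoly K[3]}.
Notation Der := 'rV[{mpoly K[3]}]_3.
Notation E := (eulerD K).
Implicit Types (A : {fset {vspace 'rV[K]_3}}) (t a b c : Der) (f g : S).
Implicit Types (L H : {vspace 'rV[K]_3}) (k : 'I_3).

(** All that the algebra below needs to know about forms of distinct planes. *)
Definition reduced_forms A :=
  (forall L, L \in A -> alpha L \is 1.-homog /\ alpha L != 0) /\
  (forall L L', L \in A -> L' \in A -> L != L' -> ~ divides (alpha L) (alpha L')).

Lemma reduced_formsS A H : reduced_forms A -> reduced_forms (A `\ H)%fset.
Proof.
case=> hA cA; split=> [L|L L']; first by case/fsetD1P=> _; apply: hA.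
by move=> /fsetD1P[_ LA] /fsetD1P[_ LA']; apply: cA.
Qed.

Lemma reduced_prime A L : reduced_forms A -> L \in A -> prime_elt (alpha L).
Proof. by case=> hA _ /hA[? ?]; apply: dhomog1_prime. Qed.

Lemma Qpoly_dhomog A : reduced_forms A -> Qpoly alpha A \is #|` A|.-homog.
Proof.
case=> hA _; rewrite card_fset_sum1.
by apply: dhomog_prod_seq => L /hA[].
Qed.

Lemma Qpoly_neq0 A : reduced_forms A -> Qpoly alpha A != 0.
Proof.
case=> hA _; rewrite /Qpoly prodf_seq_neq0; apply/allP=> L /hA[_ L0].
exact/implyP.
Qed.

Lemma Qpoly_D1 A H : H \in A -> Qpoly alpha A = alpha H * Qpoly alpha (A `\ H)%fset.
Proof. by move=> HA; rewrite /Qpoly (big_fsetD1 H). Qed.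

Lemma Qpoly_D1_ndiv A H : reduced_forms A -> H \in A ->
  ~ divides (alpha H) (Qpoly alpha (A `\ H)%fset).
Proof.
move=> rA HA /(prime_prod (reduced_prime rA HA)); case.
  by case: rA => /(_ H HA)[hH _] _; apply: dhomog1_not_unit.
by move=> L /fsetD1P[LH LA]; apply: (proj2 rA) => //; rewrite eq_sym.
Qed.

Lemma alpha_divides_Qpoly A L : L \in A -> divides (alpha L) (Qpoly alpha A).
Proof. by move=> /Qpoly_D1->; apply: dividesMr; apply: dividesxx. Qed.

Lemma logderD A t1 t2 : logder alpha A t1 -> logder alpha A t2 ->
  logder alpha A (t1 + t2).
Proof.
by move=> h1 h2 L LA; rewrite der_appD; apply: dividesD; [apply: h1 | apply: h2].
Qed.

Lemma logderZ A g t : logder alpha A t -> logder alpha A (g *: t).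
Proof. by move=> ht L LA; rewrite der_appZ; apply: dividesMl; apply: ht. Qed.

Lemma logderB A t1 t2 : logder alpha A t1 -> logder alpha A t2 ->
  logder alpha A (t1 - t2).
Proof. by move=> h1 h2; rewrite -scaleN1r; apply/logderD/logderZ. Qed.

Lemma logder_euler A : reduced_forms A -> logder alpha A E.
Proof. by case=> hA _ L /hA[hL _]; rewrite euler_app //; apply: dividesxx. Qed.

Lemma logder_sub A H t : logder alpha A t -> logder alpha (A `\ H)%fset t.
Proof. by move=> ht L /fsetD1P[_]; apply: ht. Qed.

Lemma logder_mulform A H t : logder alpha (A `\ H)%fset t ->
  logder alpha A (alpha H *: t).
Proof.
move=> ht L LA; rewrite der_appZ.
have [->|LH] := eqVneq L H; first by apply: dividesMr; apply: dividesxx.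
by apply: dividesMl; apply: ht; rewrite !inE LH.
Qed.

Lemma logder_add_back A H t : logder alpha (A `\ H)%fset t ->
  divides (alpha H) (der_app t (alpha H)) -> logder alpha A t.
Proof.
move=> ht dH L LA; have [->|LH] := eqVneq L H; first exact: dH.
by apply: ht; rewrite !inE LH.
Qed.

Lemma logder_Qpoly A t : logder alpha A t ->
  divides (Qpoly alpha A) (der_app t (Qpoly alpha A)).
Proof.
move=> ht; rewrite /Qpoly big_seq.
elim/big_rec: _ => [|L q LA [g eg]]; first by rewrite der_app1; exists 0; rewrite mul0r.
have [h eh] := ht L LA; exists (h + g).
by rewrite der_appM eg eh; ring.
Qed.

Lemma euler_Qpoly A : reduced_forms A ->
  der_app E (Qpoly alpha A) = #|` A|%:R * Qpoly alpha A.
Proof.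
case=> hA _; rewrite card_fset_sum1 /Qpoly big_seq [in RHS]big_seq.
elim/big_rec2: _ => [|L n q LA eq]; first by rewrite der_app1 mul0r.
by rewrite der_appM eq euler_app ?(proj1 (hA L LA)) // natrD; ring.
Qed.

(** The forms being pairwise coprime, [t(Q)] can only be divisible by [alpha_L]
    if [t(alpha_L)] is. *)
Lemma logder0_logder A t : reduced_forms A -> logder0 alpha A t -> logder alpha A t.
Proof.
move=> rA + L LA; rewrite /logder0 (Qpoly_D1 LA) der_appM => e0.
have : divides (alpha L) (der_app t (alpha L) * Qpoly alpha (A `\ L)%fset).
  move/eqP: e0; rewrite addr_eq0 => /eqP->; rewrite -mulrN.
  by apply: dividesMr; apply: dividesxx.
by case/(reduced_prime rA LA) => // /(Qpoly_D1_ndiv rA LA).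
Qed.

(** * Degrees of proper logarithmic derivations *)

Definition proper_logder A e t :=
  [/\ der_homog e t, logder alpha A t & forall g, t <> g *: E].

(** As [D(A) = D_0(A) + S E], the invariant [mdr] is also the least degree of a
    logarithmic derivation outside [S E]; the projection of [t] to [D_0(A)] is
    proportional to [n t - (t(Q)/Q) E] with [n] the number of planes, and this is
    where the characteristic matters. *)
Lemma logder0_nonzeroP A e : [pchar K] =i pred0 -> reduced_forms A -> A != fset0 ->
  logder0_nonzero alpha A e <-> exists t, proper_logder A e t.
Proof.
move=> charK rA A0.
have n0 : #|` A|%:R != 0 :> K.
  by move/pcharf0P: charK => ->; rewrite cardfs_eq0.
have nS0 : (#|` A|%:R : S) != 0 by rewrite -(rmorph_nat (@mpolyC 3 K)) mpolyC_eq0.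
have Q0 := Qpoly_neq0 rA; have hQ := Qpoly_dhomog rA.
split=> [[t [t0 ht lt]]|[t [ht lt nE]]].
  exists t; split=> //; first exact: logder0_logder.
  move=> g tE; move: lt; rewrite /logder0 tE der_appZ euler_Qpoly // => /eqP.
  rewrite !mulf_eq0 (negPf Q0) (negPf nS0) !orbF => /eqP g0.
  by move: t0; rewrite tE g0 scale0r eqxx.
have [g eg] := logder_Qpoly lt.
pose t' := #|` A|%:R *: t - g *: E.
exists t'; split; last first.
- by rewrite /logder0 /t' der_appB !der_appZ euler_Qpoly // eg; ring.
- have hgQ : g * Qpoly alpha A \is (e + #|` A|.-1).-homog.
    rewrite -eg; apply: rpred_sum => i _; apply: dhomogM; first exact: ht.
    apply/dhomogP=> m; rewrite mcoeff_msupp mcoeff_mderiv => nz.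
    have : (m + U_(i))%MM \in msupp (Qpoly alpha A).
      by rewrite mcoeff_msupp; apply: contraNneq nz => ->; rewrite mul0rn.
    by move/(dhomogP _ _ _ hQ) => /= <-; rewrite mdegD mdeg1 addn1.
  move=> i; rewrite !mxE rpredB //.
    by rewrite mulr_natl rpredMn //; apply: ht.
  have [->|gX0] := eqVneq g 0; first by rewrite mul0r rpred0.
  have gQ0 : g * Qpoly alpha A != 0 by rewrite mulf_neq0.
  have [le hg] := dhomog_quotient Q0 hQ gQ0 hgQ.
  have A1 : (0 < #|` A|)%N by rewrite cardfs_gt0.
  have -> : e = ((e + #|` A|.-1 - #|` A|) + 1)%N.
    by move: (#|` A|) le A1 {hQ hgQ ht hg} => n; lia.
  by apply: dhomogM => //; rewrite dhomogX /= mdeg1.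
- apply/eqP=> /eqP; rewrite subr_eq0 => /eqP nt.
  apply: (nE ((#|` A|%:R^-1)%:MP * g)); rewrite -scalerA -nt scalerA.
  rewrite -(rmorph_nat (@mpolyC 3 K)) -mpolyCM mulVf // mpolyC1.
  by rewrite scale1r.
Qed.

(** * Saito's criterion *)

(** Cramer's rule, replacing the [k]-th column by the values on the form [f]. *)
Lemma der_det_form f k a b c : f \is 1.-homog ->
  let i := k + 1 in let j := k + 1 + 1 in
  (f@_U_(k))%:MP * der_det a b c =
    der_app a f * (b 0 i * c 0 j - b 0 j * c 0 i) +
    der_app b f * (c 0 i * a 0 j - c 0 j * a 0 i) +
    der_app c f * (a 0 i * b 0 j - a 0 j * b 0 i).
Proof.
move=> hf i j; rewrite !der_app_lin // !(big_ord3 _ k) (der_detE k).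
exact: cramer3.
Qed.

Lemma der_det_divides A L a b c : reduced_forms A -> L \in A ->
  logder alpha A a -> logder alpha A b -> logder alpha A c ->
  divides (alpha L) (der_det a b c).
Proof.
move=> rA LA la lb lc; have [hL L0] := (proj1 rA) L LA.
have [k k0] := lin_neq0 hL L0.
suff [g eg] : divides (alpha L) (((alpha L)@_U_(k))%:MP * der_det a b c).
  exists ((((alpha L)@_U_(k))^-1)%:MP * g).
  by rewrite -mulrA -eg mulrA -mpolyCM mulVf // mpolyC1 mul1r.
rewrite der_det_form //.
by apply: dividesD; [apply: dividesD|]; apply: dividesMr;
  [apply: la | apply: lb | apply: lc].
Qed.

Lemma Qpoly_divides_det A a b c : reduced_forms A ->
  logder alpha A a -> logder alpha A b -> logder alpha A c ->
  divides (Qpoly alpha A) (der_det a b c).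
Proof.
move=> rA la lb lc; apply: prod_divides => [|L LA|L L' LA LA' LL'].
- exact: fset_uniq.
- exact: (der_det_divides rA).
- by apply: coprime_to_prime (reduced_prime rA LA) _; apply: (proj2 rA).
Qed.

(** Coprimality is symmetric when one of the two elements is a nonzero prime. *)
Lemma coprime_to_alpha A f L : reduced_forms A -> L \in A ->
  ~ divides (alpha L) f -> coprime_to f (alpha L).
Proof.
move=> rA LA nLf h [g eg]; have L0 := proj2 (proj1 rA L LA).
have : divides (alpha L) (g * f) by rewrite -eg; apply: dividesMr; apply: dividesxx.
case/(reduced_prime rA LA)=> // -[g' eg'].
by exists g'; apply: (mulfI L0); rewrite eg eg'; ring.
Qed.

Lemma coprime_to_Qpoly A f : reduced_forms A ->
  (forall L, L \in A -> ~ divides (alpha L) f) -> coprime_to f (Qpoly alpha A).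
Proof.
move=> rA nLf; rewrite /Qpoly big_seq.
elim/big_rec: _ => [|L q LA IH] h; first by rewrite mul1r.
by rewrite -mulrA => /(coprime_to_alpha rA LA (nLf L LA))/IH.
Qed.

(** If [alpha_L = f], the three derivations [Q d_k], [(Q/f) (f_k d_i - f_i d_k)]
    and [(Q/f) (f_k d_j - f_j d_k)] are logarithmic. Their determinant is
    [f_k^2 Q (Q/f)^2], and any basis has a determinant dividing it. *)
Lemma basis_det_divides A L a b c : reduced_forms A -> L \in A ->
    is_basis (logder alpha A) (fun i => [:: a; b; c]`_i) ->
  exists2 u, u != 0 :> K &
    divides (der_det a b c)
      (u%:MP * (Qpoly alpha A * (Qpoly alpha (A `\ L)%fset * Qpoly alpha (A `\ L)%fset))).
Proof.
move=> rA LA [_ basis]; have [hL L0] := (proj1 rA) L LA.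
have [k k0] := lin_neq0 hL L0; set f := alpha L in hL k0.
set q := Qpoly alpha (A `\ L)%fset; set Q := Qpoly alpha A.
(* The factor [f_k^2] of the determinant announced above. *)
exists (f@_U_(k) * f@_U_(k)); first by rewrite mulf_neq0.
pose i := k + 1; pose j := k + 1 + 1.
pose d l : Der := delta_mx 0 l.
have dE l m : d l 0 m = (m == l)%:R by rewrite mxE eqxx.
have der_d l g : g \is 1.-homog -> der_app (d l) g = (g@_U_(l))%:MP.
  move=> hg; rewrite der_app_lin // (bigD1 l) //= dE eqxx mulr1.
  by rewrite big1 ?addr0 // => m /negPf ml; rewrite dE ml mulr0.
have [w wE lw] : exists2 w : 'I_3 -> Der,
    forall l m, w l 0 m =
      q * ((f@_U_(k))%:MP * (m == l)%:R - (f@_U_(l))%:MP * (m == k)%:R)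
    & forall l, logder alpha A (w l).
  exists (fun l => q *: ((f@_U_(k))%:MP *: d l - (f@_U_(l))%:MP *: d k)) => [l m|l].
    by rewrite !mxE eqxx.
  move=> L' LA'; rewrite der_appZ.
  have [->|LL'] := eqVneq L' L; last first.
    by apply: dividesMr; apply: alpha_divides_Qpoly; rewrite !inE LL'.
  rewrite der_appB !der_appZ !der_d // [X in X - _]mulrC subrr mulr0.
  by exists 0; rewrite mul0r.
have [v vE lv] : exists2 v : Der,
    forall m, v 0 m = Q * (m == k)%:R & logder alpha A v.
  exists (Q *: d k) => [m|L' LA']; first by rewrite !mxE eqxx.
  by rewrite der_appZ; apply: dividesMr; exact: alpha_divides_Qpoly.
have [c1 [e1 _]] := basis _ lv; have [c2 [e2 _]] := basis _ (lw i).
have [c3 [e3 _]] := basis _ (lw j).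
exists (\det (\matrix_(m < 3) [:: c1; c2; c3]`_m)).
rewrite -der_det_comb -e1 -e2 -e3.
have ik : (i == k) = false by rewrite /i; case: (k) => [[|[|[|//]]] ?].
have jk : (j == k) = false by rewrite /j; case: (k) => [[|[|[|//]]] ?].
have ij : (i == j) = false by rewrite /i /j; case: (k) => [[|[|[|//]]] ?].
rewrite (@der_det_triangular _ k) -/i -/j ?vE ?wE ?eqxx ?ik ?jk ?[j == i]eq_sym ?ij;
  rewrite ?mulr0 ?mulr1 ?subr0 ?mulr0 //.
by rewrite mpolyCM [LHS]mulrCA; congr (_ * _); rewrite [RHS]mulrACA [LHS]mulrC.
Qed.

(** Saito's criterion. By the previous lemma the cofactor [f] of [Q] in the
    determinant divides [u (Q/alpha_L)^2] for each plane [L]; it is thus coprime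
    to every [alpha_L] and yet divides a product of these forms. *)
Lemma saito A a b c : reduced_forms A -> A != fset0 ->
    is_basis (logder alpha A) (fun i => [:: a; b; c]`_i) ->
  exists2 u, u != 0 & der_det a b c = u *: Qpoly alpha A.
Proof.
move=> rA /fset0Pn[L0 LA0] basis; have Q0 := Qpoly_neq0 rA.
have [la lb lc] : [/\ logder alpha A a, logder alpha A b & logder alpha A c].
  by case: basis => lb _; split; [have := lb 0 | have := lb 1 | have := lb (1 + 1)].
have [f ef] := Qpoly_divides_det rA la lb lc.
have df L : L \in A -> exists2 u, u != 0 :> K &
    divides f (u%:MP * (Qpoly alpha (A `\ L)%fset * Qpoly alpha (A `\ L)%fset)).
  move=> LA; have [u u0 du] := basis_det_divides rA LA basis; exists u => //.
  apply: (divides_cancel Q0); rewrite mulrCA.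
  by rewrite [_ * f]mulrC -ef.
have nf L : L \in A -> ~ divides (alpha L) f.
  move=> LA dLf; have [u u0 du] := df L LA.
  have := divides_trans dLf du.
  case/(reduced_prime rA LA) => [|/(reduced_prime rA LA)[]]; try exact: Qpoly_D1_ndiv.
  case=> g eg; apply: (dhomog1_not_unit (proj1 (proj1 rA L LA))).
  by exists ((u^-1)%:MP * g); rewrite -mulrA -eg -mpolyCM mulVf // mpolyC1.
have [u u0] := df L0 LA0.
have rA0 := @reduced_formsS _ L0 rA.
have cf : coprime_to f (Qpoly alpha (A `\ L0)%fset).
  by apply: coprime_to_Qpoly => // L /fsetD1P[_]; apply: nf.
rewrite mulrC -mulrA => /cf/cf [g] e.
(* Now [f] divides the nonzero constant [u]. *)
have [v ev] : exists v, f = v%:MP.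
  have f0 : f != 0 by apply: contraNneq u0 => f0; move/eqP: e; rewrite f0 mulr0 mpolyC_eq0.
  have g0 : g != 0 by apply: contraNneq u0 => g0; move/eqP: e; rewrite g0 mul0r mpolyC_eq0.
  have /msize_poly1P[v _ ->] : msize f == 1%N; last by exists v.
  have := congr1 (mmeasure mdeg) e; rewrite msizeM // msizeC u0 /=.
  by move: f0 g0; rewrite -!msize_poly_eq0; lia.
exists v; last by rewrite ef ev mul_mpolyC.
apply: contraNneq u0 => v0; move: e; rewrite ev v0 mpolyC0 mulr0 => /eqP.
by rewrite mpolyC_eq0.
Qed.

End Logarithmic.

(** * Free arrangements *)

Section Free.
Variables (K : fieldType) (alpha : {vspace 'rV[K]_3} -> {mpoly K[3]}).
Notation S := {mpoly K[3]}.
Notation Der := 'rV[{mpoly K[3]}]_3.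
Notation E := (eulerD K).
Implicit Types (s t u v : Der) (f g p q x y z : S).

Lemma exchange_id (R : comRingType) (s0 s1 s2 t0 t1 t2 u0 u1 u2 x y z : R) :
  s0 * ((x * s1 + y * t1 + z * u1) * u2 - (x * s2 + y * t2 + z * u2) * u1) +
  s1 * ((x * s2 + y * t2 + z * u2) * u0 - (x * s0 + y * t0 + z * u0) * u2) +
  s2 * ((x * s0 + y * t0 + z * u0) * u1 - (x * s1 + y * t1 + z * u1) * u0) =
  y * (s0 * (t1 * u2 - t2 * u1) + s1 * (t2 * u0 - t0 * u2) + s2 * (t0 * u1 - t1 * u0)).
Proof. ring. Qed.

Lemma der_det_exchange s t u v x y z : v = x *: s + y *: t + z *: u ->
  der_det s v u = y * der_det s t u.
Proof.
move=> ev; have vE m : v 0 m = x * s 0 m + y * t 0 m + z * u 0 m.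
  by rewrite ev !mxE.
rewrite !(der_detE 0) /= !vE; exact: exchange_id.
Qed.

Lemma der_det_swap s t u : der_det s u t = - der_det s t u.
Proof.
have swap (R : comRingType) (s0 s1 s2 t0 t1 t2 u0 u1 u2 : R) :
    s0 * (u1 * t2 - u2 * t1) + s1 * (u2 * t0 - u0 * t2) + s2 * (u0 * t1 - u1 * t0) =
    - (s0 * (t1 * u2 - t2 * u1) + s1 * (t2 * u0 - t0 * u2) + s2 * (t0 * u1 - t1 * u0)).
  by ring.
rewrite !(der_detE 0); exact: swap.
Qed.

Lemma der_det_neq0_proper t u g : der_det E t u != 0 -> t <> g *: E.
Proof.
move=> dtu et; move: dtu; rewrite (@der_det_exchange E 0 u t g 0 0) ?mul0r ?eqxx //.
by rewrite et scale0r scale0r addr0 addr0.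
Qed.

Lemma der_det_dhomog d e d' s t u : der_homog d s -> der_homog e t ->
  der_homog d' u -> der_det s t u \is (d + (e + d'))%N.-homog.
Proof.
move=> hs ht hu; rewrite (der_detE 0).
have h2 i j : t 0 i * u 0 j - t 0 j * u 0 i \is (e + d').-homog.
  by apply: rpredB; apply: dhomogM; try exact: ht; exact: hu.
by apply: rpredD; [apply: rpredD|]; apply: dhomogM; try exact: hs; exact: h2.
Qed.

Variables (A : {fset {vspace 'rV[K]_3}}) (d2 d3 : nat) (t2 t3 : Der).
Hypotheses (rA : reduced_forms alpha A) (A0 : A != fset0).
Hypotheses (ht2 : der_homog d2 t2) (ht3 : der_homog d3 t3).
Hypothesis basis : is_basis (logder alpha A) (fun i => [:: E; t2; t3]`_i).

Let l2 : logder alpha A t2. Proof. exact: (proj1 basis 1). Qed.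
Let l3 : logder alpha A t3. Proof. exact: (proj1 basis (1 + 1)). Qed.

Lemma free_det_neq0 : der_det E t2 t3 != 0.
Proof.
have [c c0 ->] := saito rA A0 basis.
by rewrite -mul_mpolyC mulf_neq0 ?mpolyC_eq0 // Qpoly_neq0.
Qed.

Lemma free_card : #|` A| = (1 + d2 + d3)%N.
Proof.
have [c c0 ec] := saito rA A0 basis.
rewrite -addnA; apply: dhomog_uniq free_det_neq0 _ _.
  by rewrite ec; apply: rpredZ; apply: Qpoly_dhomog.
exact: der_det_dhomog (euler_homog K) ht2 ht3.
Qed.

(** The coordinates of a homogeneous derivation in a homogeneous basis can be
    replaced by their components of the degrees that count. *)
Lemma free_coords e t : der_homog e t -> logder alpha A t ->
  exists x y z, [/\ t = x *: E + y *: t2 + z *: t3,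
    (if (d2 <= e)%N then is_true (y \is (e - d2).-homog) else y = 0)
  & (if (d3 <= e)%N then is_true (z \is (e - d3).-homog) else z = 0)].
Proof.
move=> ht lt; have [c [ec _]] := (proj2 basis) t lt.
pose cut (d : nat) (y : S) := if (d <= e)%N then pihomog mdeg (e - d) y else 0.
exists (cut 1%N (c 0 0)), (cut d2 (c 0 1)), (cut d3 (c 0 (1 + 1))).
have cutP d y : if (d <= e)%N then is_true (cut d y \is (e - d).-homog) else cut d y = 0.
  by rewrite /cut; case: (d <= e)%N => //; apply: pihomogP.
split; [rewrite /cut | exact: cutP | exact: cutP].
have ec' : t = c 0 0 *: E + c 0 1 *: t2 + c 0 (1 + 1) *: t3.
  by rewrite {1}ec (big_ord3 _ 0) add0r.
apply/rowP=> i; rewrite -(pihomog_dE (ht i)) {1}ec'.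
have hE := euler_homog K.
rewrite !mxE !pihomogD (pihomogM _ _ (ht2 i)) (pihomogM _ _ (ht3 i)).
have := pihomogM e (c 0 0) (hE i); rewrite mxE => ->.
by do !case: ifP => _; rewrite ?mul0r.
Qed.

Hypothesis d23 : (d2 <= d3)%N.

Lemma free_proper_leq e t : proper_logder alpha A e t -> (d2 <= e)%N.
Proof.
case=> ht lt nE; rewrite leqNgt; apply/negP=> ed2.
have [x [y [z [et]]]] := free_coords ht lt.
rewrite (ltn_geF ed2) (ltn_geF (leq_trans ed2 d23)) => y0 z0.
by apply: (nE x); rewrite et y0 z0 !scale0r !addr0.
Qed.

Lemma free_proper_t2 : proper_logder alpha A d2 t2.
Proof. by split=> // g; apply: der_det_neq0_proper free_det_neq0. Qed.

(** The coordinate of [t] on [t2], and for [d2 = d3] also the one on [t3], is a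
    constant, and one of them is nonzero: [t] can replace the corresponding element
    of the basis, and the other element has degree [d3]. *)
Lemma free_exchange t : proper_logder alpha A d2 t ->
  exists u c, [/\ der_homog d3 u, logder alpha A u, c != 0 &
                  der_det E t u = c *: Qpoly alpha A].
Proof.
case=> ht lt nE; have [c c0 ec] := saito rA A0 basis.
have [x [y [z [et]]]] := free_coords ht lt.
rewrite leqnn subnn => /dhomog_const[y' ey] hz.
have [y0|y0] := eqVneq y' 0; last first.
  exists t3, (y' * c); split=> //; first by rewrite mulf_neq0.
  by rewrite (der_det_exchange et) ec ey mul_mpolyC scalerA.
move: hz; case: leqP => [d32|_ z0]; last first.
  by case: (nE x); rewrite et ey y0 z0 mpolyC0 !scale0r !addr0.
have ed : d3 = d2 by apply/eqP; rewrite eqn_leq d32.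
rewrite ed subnn => /dhomog_const[z' ez].
have z0 : z' != 0.
  by apply/eqP=> z0; case: (nE x); rewrite et ey y0 ez z0 mpolyC0 !scale0r !addr0.
exists t2, (- (z' * c)); split=> //; first by rewrite oppr_eq0 mulf_neq0.
have et' : t = x *: E + z *: t3 + y *: t2 by rewrite et addrAC.
by rewrite (der_det_exchange et') der_det_swap ec ez mul_mpolyC scalerN scalerA scaleNr.
Qed.

(** A graded [K]-linear map whose values on [D(A)] are divisible by [p] kills a
    derivation of degree [d2] outside [S E], provided that [p] has the degree of
    the value on [t3]: the value on [t2] vanishes when [d2 < d3], and both values
    are scalar multiples of [p] when [d2 = d3]. *)
Lemma free_kernel (phi : Der -> S) p r :
    (forall c t u, phi (c%:MP *: t + u) = c%:MP * phi t + phi u) ->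
    (forall e t, der_homog e t -> logder alpha A t ->
       phi t \is (e + r).-homog /\ divides p (phi t)) ->
    p \is (d3 + r).-homog ->
  exists2 t, proper_logder alpha A d2 t & phi t = 0.
Proof.
move=> phiL phiP hp; have [hphi2 dphi2] := phiP _ _ ht2 l2.
have [hphi3 dphi3] := phiP _ _ ht3 l3.
have [phi2|phi2] := eqVneq (phi t2) 0; first by exists t2 => //; apply: free_proper_t2.
have ed : d3 = d2.
  apply/eqP; rewrite eqn_leq d23 andbT -(leq_add2r r).
  exact: dhomog_divides_leq hp hphi2 phi2 dphi2.
rewrite ed in hp hphi3.
have [c2 e2] := dhomog_divides_eq hp hphi2 dphi2.
have [c3 e3] := dhomog_divides_eq hp hphi3 dphi3.
have c20 : c2 != 0 by apply: contraNneq phi2 => c20; rewrite e2 c20 scale0r.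
(* The values on [t2] and [t3] are [c2 *: p] and [c3 *: p]. *)
exists ((- (c3 / c2))%:MP *: t2 + t3); last first.
  rewrite phiL e2 e3 mul_mpolyC scalerA mulNr divfK // scaleNr.
  by rewrite addNr.
split.
- move=> i; rewrite !mxE mul_mpolyC; apply: rpredD; first exact/rpredZ/ht2.
  by rewrite -ed; apply: ht3.
- by apply: logderD => //; apply: logderZ.
- move=> g; apply: (@der_det_neq0_proper _ t2).
  rewrite (@der_det_exchange E t3 t2 _ 0 1 (- (c3 / c2))%:MP); last first.
    by rewrite scale0r add0r scale1r addrC.
  by rewrite mul1r der_det_swap oppr_eq0 free_det_neq0.
Qed.

End Free.

(** * Restriction to a plane of the arrangement *)

Section Restriction.
Variables (K : fieldType) (alpha : {vspace 'rV[K]_3} -> {mpoly K[3]}).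
Notation S := {mpoly K[3]}.
Notation Der := 'rV[{mpoly K[3]}]_3.
Notation V := 'rV[K]_3.
Notation E := (eulerD K).
Implicit Types (t u : Der) (f g p q x y z : S) (L X : {vspace V}).

(** If one form divides another, then the plane of the former is contained in the
    plane of the latter. *)
Lemma arrangement_reduced (A : {fset {vspace V}}) : arrangement A ->
  (forall L, L \in A -> linear_form_of L (alpha L)) -> reduced_forms alpha A.
Proof.
move=> dimA alphaP; split=> [L LA|L L' LA LA' LL' [g eg]].
  have [hL mL] := alphaP L LA; split=> //; apply/eqP=> L0.
  have : (fullv <= L)%VS by apply/subvP=> v _; rewrite mL L0 meval0.
  by move/dimvS; rewrite dimvf dimA // /dim /= mul1n.
case/eqP: LL'; apply/eqP; rewrite eqEdim !dimA // leqnn andbT.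
apply/subvP=> v; rewrite (proj2 (alphaP L LA)) (proj2 (alphaP L' LA')) => /eqP v0.
by rewrite eg mevalM v0 mulr0.
Qed.

Variables (A : {fset {vspace V}}) (H : {vspace V}) (k : 'I_3).
Hypotheses (dimA : arrangement A).
Hypothesis alphaP : forall L, L \in A -> linear_form_of L (alpha L).
Hypotheses (HA : H \in A) (k0 : (alpha H)@_U_(k) != 0).
Local Notation A' := (A `\ H)%fset.
Local Notation red p := (p \mPo red_tuple (alpha H) k).
Local Notation i := (k + 1).
Local Notation j := (k + 1 + 1).

Let rA : reduced_forms alpha A. Proof. exact: arrangement_reduced. Qed.
Let hH : alpha H \is 1.-homog. Proof. by case: (alphaP HA). Qed.

Lemma red_alpha_dhomog L : L \in A' -> red (alpha L) \is 1.-homog.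
Proof. by case/fsetD1P=> _ LA; apply: red_dhomog => //; case: (alphaP LA). Qed.

Lemma red_alpha_neq0 L : L \in A' -> red (alpha L) != 0.
Proof.
case/fsetD1P=> LH LA; apply/eqP=> /(red_eq0 hH k0).
by apply: (proj2 rA) => //; rewrite eq_sym.
Qed.

Lemma red_alpha_prime L : L \in A' -> prime_elt (red (alpha L)).
Proof.
by move=> LA; apply: dhomog1_prime; [apply: red_alpha_dhomog | apply: red_alpha_neq0].
Qed.

Lemma mem_meval L v : L \in A -> (v \in L) = ((alpha L).@[fun m => v 0 m] == 0).
Proof. by move=> LA; case: (alphaP LA). Qed.

Lemma meval_row f (v : 'I_3 -> K) : f.@[fun m => (\row_n v n) 0 m] = f.@[v].
Proof. by apply: meval_eq => m; rewrite mxE. Qed.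

(** In [H] both reduced forms are equations of the common line. *)
Lemma same_line_red L L' : L \in A' -> L' \in A' -> (H :&: L = H :&: L')%VS ->
  exists2 c, c != 0 & red (alpha L') = c *: red (alpha L).
Proof.
move=> LA LA' e; have /fsetD1P[_ LAA] := LA; have /fsetD1P[_ LAA'] := LA'.
have [c ec] : exists c, red (alpha L') = c *: red (alpha L).
  apply: (red_pencil hH k0) (red_alpha_neq0 LA) _.
  - by case: (alphaP LAA).
  - by case: (alphaP LAA').
  move=> v vH vL; rewrite -meval_row; apply/eqP; rewrite -mem_meval //.
  have : \row_n v n \in (H :&: L)%VS.
    by rewrite memv_cap !mem_meval // !meval_row vH vL eqxx.
  by rewrite e memv_cap => /andP[].
exists c => //; apply: contraNneq (red_alpha_neq0 LA') => c0.
by rewrite ec c0 scale0r.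
Qed.

Lemma red_divides_same_line L L' : L \in A' -> L' \in A' ->
  divides (red (alpha L)) (red (alpha L')) -> (H :&: L = H :&: L')%VS.
Proof.
have half M N (MA : M \in A') (NA : N \in A') c :
    red (alpha N) = c *: red (alpha M) -> (H :&: M <= H :&: N)%VS.
  have /fsetD1P[_ MAA] := MA; have /fsetD1P[_ NAA] := NA.
  move=> e; apply/subvP=> v; rewrite !memv_cap => /andP[vH vM]; rewrite vH /=.
  move: vH vM; rewrite !mem_meval // => /eqP vH /eqP vM.
  by rewrite -(red_meval k _ vH) e mevalZ (red_meval k _ vH) vM mulr0.
move=> LA LA' /(dhomog_divides_eq (red_alpha_dhomog LA) (red_alpha_dhomog LA'))[c ec].
apply/eqP; rewrite eqEsubv (half _ _ _ _ _ ec) //=.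
apply: (half _ _ _ _ c^-1) => //; rewrite ec scalerA mulVf ?scale1r //.
by apply: contraNneq (red_alpha_neq0 LA') => c0; rewrite ec c0 scale0r.
Qed.

(** A choice of one plane of [A'] through each line of the restriction; the default
    value [H] is not reached for such lines. *)
Definition plane_through X := head H [seq L <- A' | (H :&: L)%VS == X].

Lemma plane_throughP X : X \in restriction A H ->
  plane_through X \in A' /\ (H :&: plane_through X)%VS = X.
Proof.
case/imfsetP=> L /= LA eX; have : L \in [seq L <- A' | (H :&: L)%VS == X].
  by rewrite mem_filter -eX eqxx.
rewrite /plane_through.
case Es : [seq _ <- _ | _] => [//|M s] _ /=.
have : M \in [seq L <- A' | (H :&: L)%VS == X] by rewrite Es mem_head.
by rewrite mem_filter => /andP[/eqP].
Qed.

Lemma plane_through_inj X Y : X \in restriction A H -> Y \in restriction A H ->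
  divides (red (alpha (plane_through X))) (red (alpha (plane_through Y))) -> X = Y.
Proof.
move=> /plane_throughP[XA eX] /plane_throughP[YA eY].
by move/(red_divides_same_line XA YA); rewrite eX eY.
Qed.

Definition Qrestriction : S :=
  \prod_(X <- restriction A H) red (alpha (plane_through X)).

Lemma Qrestriction_dhomog : Qrestriction \is #|` restriction A H|.-homog.
Proof.
rewrite card_fset_sum1; apply: dhomog_prod_seq => X /plane_throughP[XA _].
exact: red_alpha_dhomog.
Qed.

Lemma Qrestriction_neq0 : Qrestriction != 0.
Proof.
rewrite /Qrestriction prodf_seq_neq0; apply/allP=> X /plane_throughP[XA _] /=.
exact: red_alpha_neq0.
Qed.

(** * Derivations of the arrangement along the plane *)

(** With [x_i] and [x_j] as coordinates on [H], the determinant of the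
    restrictions to [H] of the Euler derivation and of [t]. *)
Definition wedge t : S := red ('X_i * t 0 j - 'X_j * t 0 i).

Lemma wedge_linear c t u : wedge (c%:MP *: t + u) = c%:MP * wedge t + wedge u.
Proof.
rewrite /wedge !mxE.
have -> : 'X_i * (c%:MP * t 0 j + u 0 j) - 'X_j * (c%:MP * t 0 i + u 0 i) =
   c%:MP * ('X_i * t 0 j - 'X_j * t 0 i) + ('X_i * u 0 j - 'X_j * u 0 i) :> S.
  by move: (_%:MP) (t 0 i) (t 0 j) ('X_i) ('X_j) => c' *; ring.
by rewrite redD redM comp_mpolyC.
Qed.

Lemma wedge_dhomog e t : der_homog e t -> wedge t \is (e + 1).-homog.
Proof.
move=> ht; rewrite (addnC e); apply: red_dhomog => //.
by apply: rpredB; apply: dhomogM (ht _); rewrite dhomogX /= mdeg1.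
Qed.

Lemma red_logder t L : logder alpha A t -> L \in A ->
  divides (red (alpha L)) (red (der_app t (alpha L))).
Proof. by move=> lt LA; apply: red_divides; apply: lt. Qed.

Lemma red_logder_H t : logder alpha A t -> red (der_app t (alpha H)) = 0.
Proof. by move=> lt; apply/(red_eq0 hH k0); apply: lt. Qed.

Lemma wedge_pairing_j (R : comRingType) (fk fi fj gk gi gj ak ai aj bk bi bj : R) :
  (fk * gj - fj * gk) * (ai * bj - aj * bi) =
  gk * ((fk * ak + fi * ai + fj * aj) * bi - (fk * bk + fi * bi + fj * bj) * ai) -
  fk * ((gk * ak + gi * ai + gj * aj) * bi - (gk * bk + gi * bi + gj * bj) * ai).
Proof. ring. Qed.

Lemma wedge_pairing_i (R : comRingType) (fk fi fj gk gi gj ak ai aj bk bi bj : R) :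
  (fk * gi - fi * gk) * (ai * bj - aj * bi) =
  fk * ((gk * ak + gi * ai + gj * aj) * bj - (gk * bk + gi * bi + gj * bj) * aj) -
  gk * ((fk * ak + fi * ai + fj * aj) * bj - (fk * bk + fi * bi + fj * bj) * aj).
Proof. ring. Qed.

Lemma wedge_form_j f g t u : f \is 1.-homog -> g \is 1.-homog ->
  ((f@_U_(k))%:MP * (g@_U_(j))%:MP - (f@_U_(j))%:MP * (g@_U_(k))%:MP) *
    (t 0 i * u 0 j - t 0 j * u 0 i) =
  (g@_U_(k))%:MP * (der_app t f * u 0 i - der_app u f * t 0 i) -
  (f@_U_(k))%:MP * (der_app t g * u 0 i - der_app u g * t 0 i).
Proof.
move=> hf hg; rewrite !der_app_lin // !(big_ord3 _ k); exact: wedge_pairing_j.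
Qed.

Lemma wedge_form_i f g t u : f \is 1.-homog -> g \is 1.-homog ->
  ((f@_U_(k))%:MP * (g@_U_(i))%:MP - (f@_U_(i))%:MP * (g@_U_(k))%:MP) *
    (t 0 i * u 0 j - t 0 j * u 0 i) =
  (f@_U_(k))%:MP * (der_app t g * u 0 j - der_app u g * t 0 j) -
  (g@_U_(k))%:MP * (der_app t f * u 0 j - der_app u f * t 0 j).
Proof.
move=> hf hg; rewrite !der_app_lin // !(big_ord3 _ k); exact: wedge_pairing_i.
Qed.

(** The previous identities hold for the Euler derivation, [t], and the forms of
    [H] and [L]; modulo [alpha H] their right-hand sides are multiples of the form
    of [L], and the constants on the left do not both vanish since the two forms
    are independent. *)
Lemma alpha_divides_wedge t L : logder alpha A t -> L \in A' ->
  divides (red (alpha L)) (wedge t).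
Proof.
move=> lt LA; have /fsetD1P[LH LAA] := LA; have [hL _] := alphaP LAA.
set f := alpha H; set g := alpha L.
have [m mk m0] : exists2 m, m = i \/ m = j &
    f@_U_(k) * g@_U_(m) - f@_U_(m) * g@_U_(k) != 0.
  have [e1|] := eqVneq (f@_U_(k) * g@_U_(i) - f@_U_(i) * g@_U_(k)) 0; last first.
    by exists i => //; left.
  have [e2|] := eqVneq (f@_U_(k) * g@_U_(j) - f@_U_(j) * g@_U_(k)) 0; last first.
    by exists j => //; right.
  have : ~ divides f g by apply: (proj2 rA); rewrite // eq_sym.
  case; exists ((g@_U_(k) / f@_U_(k))%:MP); rewrite mul_mpolyC.
  rewrite [LHS](dhomog1_lin hL) [X in _ = _ *: X](dhomog1_lin hH) /lin scaler_sumr.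
  have gE n : f@_U_(k) * g@_U_(n) - f@_U_(n) * g@_U_(k) = 0 ->
      g@_U_(n) *: 'X_n = (g@_U_(k) / f@_U_(k)) *: (f@_U_(n) *: 'X_n) :> S.
    move/eqP; rewrite subr_eq0 => /eqP e; rewrite scalerA; congr (_ *: _).
    by apply: (mulfI k0); rewrite e mulrA mulrCA divff // mulr1 mulrC.
  apply: eq_bigr => n _; apply: gE.
  have [->|->|->] := ord3_cases k n; [|exact: e1|exact: e2].
  by rewrite mulrC subrr.
suff dc : divides (red g) ((f@_U_(k) * g@_U_(m) - f@_U_(m) * g@_U_(k))%:MP * wedge t).
  have [q eq] := dc; exists (((f@_U_(k) * g@_U_(m) - f@_U_(m) * g@_U_(k))^-1)%:MP * q).
  by rewrite -mulrA -eq mulrA -mpolyCM mulVf // mpolyC1 mul1r.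
have dM c p q x y c' p' q' x' y' :
    divides (red g) (red p) -> divides (red g) (red q) ->
    divides (red g) (red p') -> divides (red g) (red q') ->
  divides (red g) (red (c * (p * x - q * y) - c' * (p' * x' - q' * y'))).
  move=> dp dq dp' dq'; rewrite redB !redM !redB !redM.
  by apply: dividesB; apply: dividesMl; apply: dividesB; apply: dividesMr.
have d0 p : red p = 0 -> divides (red g) (red p) by move=> ->; exists 0; rewrite mul0r.
have Ef : divides (red g) (red (der_app E f)) by rewrite euler_app //; apply: d0; apply: red_self.
have Eg : divides (red g) (red (der_app E g)).
  by rewrite euler_app //; apply: dividesxx.
have tf : divides (red g) (red (der_app t f)) by apply/d0/red_logder_H.
have tg : divides (red g) (red (der_app t g)) by apply: red_logder.
have EX n : 'X_n = E 0 n by rewrite mxE.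
rewrite -(comp_mpolyC _ (red_tuple f k)) /wedge -rmorphM /= !EX mpolyCB !mpolyCM.
case: mk => ->; first by rewrite wedge_form_i //; apply: dM.
by rewrite wedge_form_j //; apply: dM.
Qed.

Lemma Qrestriction_divides_wedge t : logder alpha A t ->
  divides Qrestriction (wedge t).
Proof.
move=> lt; apply: prod_divides => [|X /plane_throughP[XA _]|X Y XR YR XY].
- exact: fset_uniq.
- exact: alpha_divides_wedge.
- have [XA _] := plane_throughP XR.
  apply: coprime_to_prime; first exact: red_alpha_prime.
  by move/(plane_through_inj XR YR)/eqP; rewrite (negPf XY).
Qed.

(** If [t] is proportional to the Euler derivation along [H], subtracting a
    multiple of the latter makes every coefficient divisible by [alpha H]. *)
Lemma wedge_eq0 t : logder alpha A t -> wedge t = 0 ->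
  exists g u, t = g *: E + alpha H *: u.
Proof.
move=> lt w0.
have ki : i != k by case: (k) => [[|[|[|//]]] ?].
have kj : j != k by case: (k) => [[|[|[|//]]] ?].
have ij : i != j by case: (k) => [[|[|[|//]]] ?].
have hX n : 'X_n \is [in K[3], 1.-homog] by rewrite dhomogX /= mdeg1.
have X0 n : 'X_n != 0 :> S.
  by apply/eqP=> /(congr1 (mcoeff U_(n))) /eqP; rewrite mcoeffXU eqxx mcoeff0 oner_eq0.
have wE : 'X_i * red (t 0 j) = 'X_j * red (t 0 i).
  move/eqP: w0; rewrite /wedge redB redM redM (redX_id (alpha H) ki) (redX_id (alpha H) kj).
  by rewrite subr_eq0 => /eqP.
have [g eg] : divides 'X_i (red (t 0 i)).
  have : divides 'X_i ('X_j * red (t 0 i)) by rewrite -wE; apply/dividesMr/dividesxx.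
  case/(dhomog1_prime (hX i) (X0 i)) => // /(dhomog_divides_eq (hX _) (hX _))[c].
  move/(congr1 (mcoeff U_(j))) => /eqP.
  by rewrite mcoeffZ !mcoeffXU eqxx (negPf ij) mulr0 oner_eq0.
have eg' : red (t 0 j) = g * 'X_j.
  by apply: (mulfI (X0 i)); rewrite wE eg mulrCA [in RHS]mulrCA [X in _ * X = _]mulrC.
pose t' := t - g *: E.
have t'E n : t' 0 n = t 0 n - g * 'X_n by rewrite !mxE.
have ti : red (t' 0 i) = 0.
  rewrite t'E redB redM (redX_id (alpha H) ki) -(red_idem hH k0).
  by rewrite eg redM (redX_id (alpha H) ki) subrr.
have tj : red (t' 0 j) = 0.
  rewrite t'E redB redM (redX_id (alpha H) kj) -(red_idem hH k0).
  by rewrite eg' redM (redX_id (alpha H) kj) subrr.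
have tk : red (t' 0 k) = 0.
  have : red (der_app t' (alpha H)) = 0.
    rewrite der_appB der_appZ euler_app // redB redM red_self //.
    by rewrite red_logder_H // mulr0 subr0.
  rewrite der_app_lin // (big_ord3 _ k) redD redD redM redM redM ti tj.
  have add0 (R : comRingType) (x y z w : R) : x * y + z * 0 + w * 0 = x * y by ring.
  rewrite add0 comp_mpolyC => /eqP.
  by rewrite mulf_eq0 mpolyC_eq0 (negPf k0) => /eqP.
have dt' n : exists q, t' 0 n = q * alpha H.
  by apply/(red_eq0 hH k0); have [->|->|->] := ord3_cases k n.
have [u uE] := fin_all_exists dt'.
exists g, (\row_n u n); apply/rowP=> n; move: (uE n); rewrite t'E !mxE => /eqP.
by rewrite subr_eq addrC [u n * _]mulrC => /eqP.
Qed.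

(** * Derivations of the deletion on the form of the plane *)

(** The form of [L'] is [c alpha_L + c' alpha_H] with [c != 0], and substituting
    it shows that the expression is, up to [c], a combination of [alpha_L'] and
    [t(alpha_L')]. *)
Lemma logder_pencil t (L L' : {vspace V}) : logder alpha A' t -> L \in A' -> L' \in A' ->
  (H :&: L = H :&: L')%VS ->
  divides (alpha L')
    (alpha L * der_app t (alpha H) - alpha H * der_app t (alpha L)).
Proof.
move=> lt LA LA' e; have [c c0 ec] := same_line_red LA LA' e.
have /fsetD1P[_ LAA] := LA; have /fsetD1P[_ LAA'] := LA'.
have hL := proj1 (proj1 rA L LAA); have hL' := proj1 (proj1 rA L' LAA').
have [c' ec'] : exists c', alpha L' - c%:MP * alpha L = c'%:MP * alpha H.
  have [||c' ec'] := @dhomog_divides_eq _ _ 1 (alpha H) (alpha L' - c%:MP * alpha L) hH.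
  - by rewrite rpredB // mul_mpolyC rpredZ.
  - apply/(red_eq0 hH k0).
    by rewrite redB redM comp_mpolyC ec mul_mpolyC subrr.
  by exists c'; rewrite ec' mul_mpolyC.
have appC (d : K) f : der_app t (d%:MP * f) = d%:MP * der_app t f.
  rewrite der_appM (_ : der_app t d%:MP = 0) ?mul0r ?add0r //.
  by rewrite /der_app big1 // => n _; rewrite mderivC mulr0.
have eL' : alpha L' = c%:MP * alpha L + c'%:MP * alpha H by rewrite -ec' addrC subrK.
have tL' : der_app t (alpha L') =
    c%:MP * der_app t (alpha L) + c'%:MP * der_app t (alpha H).
  have appD f g : der_app t (f + g) = der_app t f + der_app t g.
    by rewrite -big_split; apply: eq_bigr => n _; rewrite mderivD mulrDr.
  by rewrite {1}eL' appD !appC.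
suff [q eq] : divides (alpha L') (c%:MP *
    (alpha L * der_app t (alpha H) - alpha H * der_app t (alpha L))).
  exists ((c^-1)%:MP * q).
  by rewrite -mulrA -eq mulrA -mpolyCM mulVf // mpolyC1 mul1r.
have pencil (R : comRingType) (x y l f tl tf : R) :
    x * (l * tf - f * tl) = (x * l + y * f) * tf - f * (x * tl + y * tf) by ring.
rewrite (pencil _ _ c'%:MP) -eL' -tL'; apply: dividesB.
  by apply: dividesMr; apply: dividesxx.
by apply: dividesMl; apply: lt.
Qed.

(** Let [m] planes of [A'] pass through a line [X] of [H]. Their product divides
    the expression of the previous lemma, so that the form of [X] divides
    [t(alpha H)] with multiplicity [m - 1]; multiplying by the equation of the
    restriction makes up for the missing factors at all [X] at once. *)
Lemma red_Qpoly_divides t : logder alpha A' t ->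
  divides (red (Qpoly alpha A')) (Qrestriction * red (der_app t (alpha H))).
Proof.
move=> lt.
pose P X := \prod_(L <- A' | (H :&: L)%VS == X) red (alpha L).
have -> : red (Qpoly alpha A') = \prod_(X <- restriction A H) P X.
  by rewrite /Qpoly rmorph_prod /= (partition_big_imfset _ (fun L => (H :&: L)%VS)).
apply: prod_divides => [|X XR|X Y XR YR XY].
- exact: fset_uniq.
- have [XA eX] := plane_throughP XR.
  apply: (@divides_trans _ _ (red (alpha (plane_through X)) * red (der_app t (alpha H)))).
    have -> : P X = red (\prod_(L <- [seq L <- A' | (H :&: L)%VS == X]) alpha L).
      by rewrite rmorph_prod big_filter.
    have -> : red (alpha (plane_through X)) * red (der_app t (alpha H)) =
        red (alpha (plane_through X) * der_app t (alpha H) -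
             alpha H * der_app t (alpha (plane_through X))).
      by rewrite redB redM redM red_self // mul0r subr0.
    apply: red_divides; apply: prod_divides => [|L|L L'].
    + exact/filter_uniq/fset_uniq.
    + rewrite mem_filter => /andP[/eqP eL LA].
      by apply: logder_pencil => //; rewrite eX eL.
    + rewrite !mem_filter => /andP[_ /fsetD1P[_ LA]] /andP[_ /fsetD1P[_ LA']] LL'.
      apply: coprime_to_prime; first exact: reduced_prime rA LA.
      exact: (proj2 rA).
  rewrite /Qrestriction (big_fsetD1 X) //= mulrAC.
  by apply: dividesMr; apply: dividesxx.
- apply: coprime_to_prod => L LA /eqP eL; split.
  + exact: red_alpha_neq0.
  + exact: red_alpha_prime.
  rewrite /P -big_filter => /(prime_prod (red_alpha_prime LA)); case.
    by apply: dhomog1_not_unit; apply: red_alpha_dhomog.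
  move=> L'; rewrite mem_filter => /andP[/eqP eL' LA'].
  by move/(red_divides_same_line LA LA')/eqP; rewrite eL eL' (negPf XY).
Qed.

(** * Comparison of the arrangement and the deletion *)

Lemma proper_logder_sub t e : proper_logder alpha A e t -> proper_logder alpha A' e t.
Proof. by case=> ht lt nE; split=> //; apply: logder_sub. Qed.

(** If [alpha_H t = g E], then [alpha_H] divides [g x_i], hence [g]. *)
Lemma proper_logder_mulform t e :
  proper_logder alpha A' e t -> proper_logder alpha A (e + 1) (alpha H *: t).
Proof.
case=> ht lt nE; split=> [n||g eg].
- by rewrite mxE addnC; apply: dhomogM (ht n).
- exact: logder_mulform.
have gE n : alpha H * t 0 n = g * 'X_n.
  by have /rowP/(_ n) := eg; rewrite !mxE.
have ki : i != k by case: (k) => [[|[|[|//]]] ?].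
have /(red_eq0 hH k0)[h eh] : red g = 0.
  have : red (g * 'X_i) = 0 by rewrite -gE redM red_self // mul0r.
  rewrite redM (redX_id (alpha H) ki) => /eqP; rewrite mulf_eq0 => /orP[/eqP //|].
  move=> /eqP/(congr1 (mcoeff U_(i)))/eqP.
  by rewrite mcoeffXU eqxx mcoeff0 oner_eq0.
apply: (nE h); apply/rowP=> n; rewrite !mxE.
by apply: (mulfI (proj2 (proj1 rA H HA))); rewrite gE eh -mulrA mulrCA.
Qed.

(** The parts of the right degree of [g] and [u] satisfy the same equation. *)
Lemma proper_logder_divform t e g u : (0 < e)%N -> proper_logder alpha A e t ->
    t = g *: E + alpha H *: u ->
  exists u', proper_logder alpha A' (e - 1) u'.
Proof.
move=> e0 [ht lt nE] et.
pose g' := pihomog mdeg (e - 1) g; pose u' : Der := \row_n pihomog mdeg (e - 1) (u 0 n).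
have et' : t = g' *: E + alpha H *: u'.
  apply/rowP=> n; rewrite -(pihomog_dE (ht n)) et !mxE pihomogD.
  have hX : 'X_n \is [in K[3], 1.-homog] by rewrite dhomogX /= mdeg1.
  by rewrite (pihomogM _ _ hX) [alpha H * _]mulrC (pihomogM _ _ hH) e0 [_ * alpha H]mulrC.
exists u'; split=> [n|L /fsetD1P[LH LA]|h eh].
- by rewrite mxE; apply: pihomogP.
- have : divides (alpha L) (alpha H * der_app u' (alpha L)).
    have -> : alpha H * der_app u' (alpha L) = der_app (t - g' *: E) (alpha L).
      by rewrite et' addrC addKr der_appZ.
    by apply: (logderB lt) => //; apply/logderZ/logder_euler.
  by case/(reduced_prime rA LA) => // /(proj2 rA L H LA HA LH).
- by apply: (nE (g' + alpha H * h)); rewrite et' eh scalerA scalerDl.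
Qed.

(** By Cramer's rule the determinant is, along [H] and up to a constant, the
    product of [wedge t] and [u(alpha H)]; the two divisibilities above bound
    the degrees of both factors from below. *)
Lemma restriction_card_bounds t u d e c :
    der_homog e t -> logder alpha A t -> der_homog d u -> logder alpha A' u ->
    c != 0 -> der_det E t u = c *: Qpoly alpha A' ->
  (#|` restriction A H| <= e + 1)%N /\ (#|` A'| <= #|` restriction A H| + d)%N.
Proof.
move=> ht lt hu lu c0 edet; have rA' := reduced_formsS H rA.
have rQ0 : red (Qpoly alpha A') != 0.
  by apply/eqP=> /(red_eq0 hH k0); apply: Qpoly_D1_ndiv.
have : red (((alpha H)@_U_(k))%:MP * der_det E t u) != 0.
  rewrite edet redM comp_mpolyC comp_mpolyZ mul_mpolyC scalerA.
  by rewrite scaler_eq0 mulf_eq0 !negb_or k0 c0.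
have wE : red (E 0 i * t 0 j - E 0 j * t 0 i) = wedge t by rewrite /wedge !mxE.
rewrite der_det_form // euler_app // redD redD redM redM redM red_self //.
rewrite red_logder_H // wE mul0r mul0r add0r add0r mulf_eq0 negb_or => /andP[u0 w0].
split.
  exact: dhomog_divides_leq Qrestriction_dhomog (wedge_dhomog ht) w0
    (Qrestriction_divides_wedge lt).
apply: dhomog_divides_leq (red_Qpoly_divides lu).
- exact/red_dhomog/Qpoly_dhomog.
- apply: dhomogM Qrestriction_dhomog _.
  by apply: red_dhomog => //; apply: der_app_dhomog.
- by rewrite mulf_neq0 ?Qrestriction_neq0.
Qed.

End Restriction.

(** * Addition and deletion *)

Section MinimalDegree.
Variables (K : fieldType) (alpha : {vspace 'rV[K]_3} -> {mpoly K[3]}).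
Variable A : {fset {vspace 'rV[K]_3}}.
Hypothesis charK : [pchar K] =i pred0.
Hypothesis dimA : arrangement A.
Hypothesis alphaP : forall L, L \in A -> linear_form_of L (alpha L).
Hypothesis A0 : A != fset0.

Let rA : reduced_forms alpha A. Proof. exact: arrangement_reduced. Qed.

Lemma mdr_proper : exists t, proper_logder alpha A (mdr alpha A) t.
Proof. by apply/logder0_nonzeroP => //; case: (mdrP alphaP). Qed.

Lemma mdr_leq e t : proper_logder alpha A e t -> (mdr alpha A <= e)%N.
Proof.
move=> pt; case: (mdrP alphaP) => _; apply.
by apply/logder0_nonzeroP => //; exists t.
Qed.

End MinimalDegree.

Lemma essential_neq0 (K : fieldType) (A : {fset {vspace 'rV[K]_3}}) :
  essential A -> A != fset0.
Proof.
by apply: contra_eqN => /eqP ->; rewrite big_seq_fset0 -dimv_eq0 dimvf.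
Qed.

Section AdditionDeletion.
Variables (K : fieldType) (alpha : {vspace 'rV[K]_3} -> {mpoly K[3]}).
Variables (A : {fset {vspace 'rV[K]_3}}) (H : {vspace 'rV[K]_3}).
Hypothesis charK : [pchar K] =i pred0.
Hypothesis dimA : arrangement A.
Hypothesis alphaP : forall L, L \in A -> linear_form_of L (alpha L).
Hypotheses (HA : H \in A) (A0' : (A `\ H)%fset != fset0).
Variables (d2 d3 : nat).
Hypothesis d23 : (d2 <= d3)%N.
Notation E := (eulerD K).
Local Notation A' := (A `\ H)%fset.

Let rA : reduced_forms alpha A. Proof. exact: arrangement_reduced. Qed.
Let rA' : reduced_forms alpha A'. Proof. exact: reduced_formsS. Qed.
Let dimA' : arrangement A'. Proof. by move=> L /fsetD1P[_]; apply: dimA. Qed.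
Let alphaP' : forall L, L \in A' -> linear_form_of L (alpha L).
Proof. by move=> L /fsetD1P[_]; apply: alphaP. Qed.
Let A0 : A != fset0. Proof. by apply/fset0Pn; exists H. Qed.
Let cardA : #|` A| = #|` A'|.+1. Proof. by rewrite (cardfsD1 H) HA. Qed.

Let exists_k : exists k, (alpha H)@_U_(k) != 0.
Proof. by have [hH H0] := proj1 rA H HA; apply: lin_neq0. Qed.

Section Deletion.
Hypotheses (d2_gt0 : (0 < d2)%N) (freeA : free_with_exponents alpha A d2 d3).

Lemma mdr_deletion_leq : (mdr alpha A' <= d2)%N.
Proof.
have [t2 [t3 [ht2 ht3 basis]]] := freeA.
by apply: mdr_leq => //; apply/proper_logder_sub/(free_proper_t2 rA A0 ht2 basis).
Qed.

Lemma mdr_deletion_geq : (d2 <= mdr alpha A' + 1)%N.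
Proof.
have [t2 [t3 [ht2 ht3 basis]]] := freeA; have [k k0] := exists_k.
have [t pt] := mdr_proper charK dimA' alphaP' A0'.
have pat := proper_logder_mulform dimA alphaP HA k0 pt.
exact: (free_proper_leq ht2 ht3 basis d23 pat).
Qed.

(** A proper [t] in [D(A')] of degree [d2 - 1] gives the member [alpha_H t] of a
    basis of [D(A)]; cancelling [alpha_H] in Saito's determinant leaves a pair to
    which the bounds apply. *)
Lemma mdr_deletion_card : mdr alpha A' = (d2 - 1)%N -> #|` restriction A H| = (1 + d3)%N.
Proof.
move=> er; have [t2 [t3 [ht2 ht3 basis]]] := freeA; have [k k0] := exists_k.
have [t] := mdr_proper charK dimA' alphaP' A0'; rewrite er => pt.
have /= := proper_logder_mulform dimA alphaP HA k0 pt; rewrite subnK // => pat.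
have [u [c [hu lu c0 edet]]] := free_exchange rA A0 ht2 ht3 basis d23 pat.
have edet' : der_det E u t = (- c) *: Qpoly alpha A'.
  rewrite der_det_swap scaleNr; congr (- _).
  apply: (mulfI (proj2 (proj1 rA H HA))).
  rewrite -(@der_det_exchange _ E t u (alpha H *: t) 0 (alpha H) 0); last first.
    by rewrite !scale0r add0r addr0.
  by rewrite edet (Qpoly_D1 _ HA) scalerAr.
have [ht lt _] := pt; have c0' : - c != 0 by rewrite oppr_eq0.
have [le1 le2] := restriction_card_bounds dimA alphaP HA k0 hu lu ht lt c0' edet'.
have := free_card rA A0 ht2 ht3 basis; move: le1 le2 d2_gt0.
rewrite cardA; move: (#|` restriction A H|) (#|` A'|) => r n. lia.
Qed.

(** The equation of [A^H] has the degree [d3 + 1] of [wedge t3]. *)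
Lemma card_mdr_deletion : #|` restriction A H| = (1 + d3)%N -> mdr alpha A' = (d2 - 1)%N.
Proof.
move=> card; have [t2 [t3 [ht2 ht3 basis]]] := freeA; have [k k0] := exists_k.
have hQ : Qrestriction alpha A H k \is (d3 + 1).-homog.
  by rewrite addnC -card; exact: (Qrestriction_dhomog k alphaP HA).
have [|t pt w0] := free_kernel rA A0 ht2 ht3 basis d23
  (@wedge_linear _ alpha H k) _ hQ.
  move=> e t ht lt; split; first exact: (wedge_dhomog k alphaP HA).
  exact: (Qrestriction_divides_wedge dimA alphaP HA k0).
have [ht lt _] := pt.
have [g [u et]] := wedge_eq0 alphaP HA k0 lt w0.
have [u' pu] := proper_logder_divform dimA alphaP HA d2_gt0 pt et.
have := mdr_leq charK dimA' alphaP' A0' pu; have := mdr_deletion_geq; lia.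
Qed.

End Deletion.

Section Addition.
Hypothesis freeA' : free_with_exponents alpha A' d2 d3.

Lemma mdr_addition_geq : (d2 <= mdr alpha A)%N.
Proof.
have [t2 [t3 [ht2 ht3 basis]]] := freeA'.
have [t /(proper_logder_sub H) pt] := mdr_proper charK dimA alphaP A0.
exact: (free_proper_leq ht2 ht3 basis d23 pt).
Qed.

Lemma mdr_addition_leq : (mdr alpha A <= d2 + 1)%N.
Proof.
have [t2 [t3 [ht2 ht3 basis]]] := freeA'; have [k k0] := exists_k.
have pt := free_proper_t2 rA' A0' ht2 basis.
exact: (mdr_leq charK dimA alphaP A0 (proper_logder_mulform dimA alphaP HA k0 pt)).
Qed.

(** A proper [t] in [D(A)] of degree [d2] is a member of a basis of [D(A')]. *)
Lemma mdr_addition_card : mdr alpha A = d2 -> #|` restriction A H| = (1 + d2)%N.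
Proof.
move=> er; have [t2 [t3 [ht2 ht3 basis]]] := freeA'; have [k k0] := exists_k.
have [t] := mdr_proper charK dimA alphaP A0; rewrite er => pt.
have [u [c [hu lu c0 edet]]] :=
  free_exchange rA' A0' ht2 ht3 basis d23 (proper_logder_sub H pt).
have [ht lt _] := pt.
have [le1 le2] := restriction_card_bounds dimA alphaP HA k0 ht lt hu lu c0 edet.
have := free_card rA' A0' ht2 ht3 basis; move: le1 le2.
move: (#|` restriction A H|) (#|` A'|) => r n; lia.
Qed.

(** The polynomial [Q(A')] has the degree of the product of the equation of [A^H]
    with [t3(alpha_H)]. *)
Lemma card_mdr_addition : #|` restriction A H| = (1 + d2)%N -> mdr alpha A = d2.
Proof.
move=> card; have [t2 [t3 [ht2 ht3 basis]]] := freeA'; have [k k0] := exists_k.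
have hH := proj1 (proj1 rA H HA).
pose phi t := Qrestriction alpha A H k * (der_app t (alpha H) \mPo red_tuple (alpha H) k).
have hQ : Qpoly alpha A' \mPo red_tuple (alpha H) k \is (d3 + (1 + d2)).-homog.
  have -> : (d3 + (1 + d2) = 1 + d2 + d3)%N by rewrite addnC.
  by rewrite -(free_card rA' A0' ht2 ht3 basis); apply/red_dhomog/Qpoly_dhomog.
have [|| t pt] := free_kernel (phi := phi) rA' A0' ht2 ht3 basis d23 _ _ hQ.
- move=> c t u; rewrite /phi der_appD der_appZ redD redM comp_mpolyC mulrDr.
  by congr (_ + _); rewrite mulrCA.
- move=> e t ht lt; split; last exact: (red_Qpoly_divides dimA alphaP HA k0).
  rewrite addnC -card; apply: dhomogM; first exact: (Qrestriction_dhomog k alphaP HA).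
  by apply: red_dhomog => //; apply: der_app_dhomog.
rewrite /phi => /eqP; rewrite mulf_eq0 (negPf (Qrestriction_neq0 dimA alphaP HA k0)) /=.
move=> /eqP/(red_eq0 hH k0) dH.
have pt' : proper_logder alpha A d2 t.
  by case: pt => ht lt nE; split=> //; apply: logder_add_back lt dH.
by have := mdr_leq charK dimA alphaP A0 pt'; have := mdr_addition_geq; lia.
Qed.

End Addition.
End AdditionDeletion.

Local Open Scope fset_scope.

Theorem theorem3p6 (K : fieldType) (charK : [pchar K] =i pred0)
    (A : {fset {vspace 'rV[K]_3}}) (alpha : {vspace 'rV[K]_3} -> {mpoly K[3]})
    (H : {vspace 'rV[K]_3})
    (arrA : arrangement A)
    (alphaP : forall L, L \in A -> linear_form_of L (alpha L))
    (HA : H \in A) (essA : essential A) (essA' : essential (A `\ H)) :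
  (forall d2 d3 : nat, (1 <= d2)%N -> (d2 <= d3)%N ->
     free_with_exponents alpha A d2 d3 ->
     (mdr alpha (A `\ H) = (d2 - 1)%N <-> #|` restriction A H| = (1 + d3)%N) /\
     (#|` restriction A H| <> (1 + d3)%N -> mdr alpha (A `\ H) = d2))
  /\
  (forall d2 d3 : nat, (1 <= d2)%N -> (d2 <= d3)%N ->
     free_with_exponents alpha (A `\ H) d2 d3 ->
     (mdr alpha A = (d2 + 1)%N <-> #|` restriction A H| <> (1 + d2)%N) /\
     (#|` restriction A H| = (1 + d2)%N -> mdr alpha A = d2)).
Proof.
have A0' := essential_neq0 essA'.
split=> d2 d3 d2_gt0 d23 free.
  have le := mdr_deletion_leq charK arrA alphaP HA A0' free.
  have ge := mdr_deletion_geq charK arrA alphaP HA A0' d23 free.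
  have toC := mdr_deletion_card charK arrA alphaP HA A0' d23 d2_gt0 free.
  have ofC := card_mdr_deletion charK arrA alphaP HA A0' d23 d2_gt0 free.
  split; first by split.
  have : #|` restriction A H| <> (1 + d3)%N -> mdr alpha (A `\ H) <> (d2 - 1)%N.
    by move=> nc /toC.
  by move=> + nc => /(_ nc); lia.
have le := mdr_addition_leq charK arrA alphaP HA A0' free.
have ge := mdr_addition_geq charK arrA alphaP HA d23 free.
have toC := mdr_addition_card charK arrA alphaP HA A0' d23 free.
have ofC := card_mdr_addition charK arrA alphaP HA A0' d23 free.
split; last exact: ofC.
split=> [er /ofC|nc]; first by rewrite er; lia.
have : mdr alpha A <> d2 by move=> /toC.
by lia.
Qed.
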